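(* Let $2\leq s<\infty$ be an integer and let $\{3,3,5\}$ denote the 600-cell. Then $2^{\{3,3,5\},\mathcal{G}(s)}$ is a regular $5$-polytope of type $\{4,3,3,5\}$ with automorphism group $D_s^{60}\rtimes[3,3,5]$ of order $14400\cdot(2s)^{60}$. Moreover, the group $G(2^{\{3,3,5\},\mathcal{G}(s)})=\langle\rho_0,\rho_1,\rho_2,\rho_3,\rho_4\rangle$ is the quotient of the Coxeter group $[4,3,3,5]$ by the relations $$(\rho_0\beta^{-i}\rho_0\beta^i)^2=id\ \text{ for } i\in\{4,6,7,9,10,12\},\quad\text{and}\quad(\rho_0\beta^{15}\rho_0\beta^{15})^s=id,$$ where $\beta=\rho_1\rho_2\rho_3\rho_4$.
   Context: C-groups and polytopes: a C-group of rank $m$ is a group $G$ with generating involutions $\rho_0,\dots,\rho_{m-1}$ satisfying $\langle\rho_i\mid i\in I\rangle\cap\langle\rho_j\mid j\in J\rangle=\langle\rho_k\mid k\in I\cap J\rangle$ for all $I,J\subseteq\{0,\dots,m-1\}$; it is a string C-group if $(\rho_i\rho_j)^2=id$ whenever $|i-j|\geq 2$. Abstract regular polytopes $\mathcal{P}$ of rank $m$ are in one-to-one correspondence with string C-groups $G(\mathcal{P})$ of rank $m$: the $i$-faces are the right cosets of $\langle\rho_j\mid j\neq i\rangle$, and vertices are the $0$-faces. The Schläfli type is $\{p_1,\dots,p_{m-1}\}$, $p_i$ being the order of $\rho_{i-1}\rho_i$, and $[p_1,\dots,p_{m-1}]$ denotes the corresponding Coxeter group with linear diagram. Construction of $2^{\mathcal{P},\mathcal{G}(s)}$: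 let $\mathcal{P}$ be a centrally symmetric regular $n$-polytope with group $G(\mathcal{P})=\langle\tau_0,\dots,\tau_{n-1}\rangle$, i.e. $G(\mathcal{P})$ has a proper central involution $\alpha$ fixing no vertex. Let $F_0$ be the base vertex, stabilized by $\langle\tau_1,\dots,\tau_{n-1}\rangle$. Let $W$ be the Coxeter group generated by involutions $\sigma_F$, one for each vertex $F$ of $\mathcal{P}$, with defining relations $\sigma_F^2=id$, $(\sigma_F\sigma_{F\alpha})^s=id$, and $(\sigma_F\sigma_{F'})^2=id$ for $F'\notin\{F,F\alpha\}$; so $W\cong D_s^{q}$, where $q$ is half the number of vertices and $D_s$ is the dihedral group of order $2s$. The group $G(\mathcal{P})$ acts on $W$ by $\tau^{-1}\sigma_F\tau=\sigma_{F\tau}$. Then $2^{\mathcal{P},\mathcal{G}(s)}$ is the regular $(n+1)$-polytope with group $G(2^{\mathcal{P},\mathcal{G}(s)}):=W\rtimes G(\mathcal{P})=\langle\rho_0,\dots,\rho_n\rangle$, where $\rho_0:=\sigma_{F_0}$ and $\rho_i:=\tau_{i-1}$ for $1\leq i\leq n$. For the 600-cell, $G(\mathcal{P})=[3,3,5]$ has order $14400$, there are $120$ vertices, and $\alpha=(\tau_0\tau_1\tau_2\tau_3)^{15}$. *)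

(* Defs.v *)
From HB Require Import structures.
From mathcomp Require Import all_boot all_fingroup all_solvable generic_quotient.
From mathcomp Require Import boolp classical_sets functions cardinality.

Set Implicit Arguments.
Unset Strict Implicit.
Unset Printing Implicit Defensive.

Local Open Scope quotient_scope.
Local Open Scope classical_set_scope.
Local Open Scope group_scope.

Definition subgroup (G : groupType) (H : set G) : Prop :=
  [/\ H 1, forall x y, H x -> H y -> H (x * y) & forall x, H x -> H x^-1].

Definition normal_subgroup (G : groupType) (N : set G) : Prop :=
  subgroup N /\ forall x g, N x -> N (x ^ g).

Definition gen (G : groupType) (A : set G) : set G := smallest (@subgroup G) A.

Definition normal_closure (G : groupType) (A : set G) : set G :=
  smallest (@normal_subgroup G) A.

Definition has_order (G : groupType) (x : G) (k : nat) : Prop :=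
  [/\ (0 < k)%N, x ^+ k = 1 & forall j, (0 < j < k)%N -> x ^+ j <> 1].

Definition isomorphic (G H : groupType) : Prop :=
  exists f : {multiplicative G -> H}, bijective f.

(* [f] exhibits [H] as the quotient of [G] by the relations [x = 1], [x] in A. *)
Definition is_quotient_by (G H : groupType) (f : G -> H) (A : set G) : Prop :=
  (forall y, exists x, f x = y) /\ f @^-1` [set 1] = normal_closure A.

(* Abstract regular polytopes of rank [m] are identified with string C-groups *)
(* of rank [m], via their automorphism groups with distinguished generators;  *)
(* the [i]-faces are the right cosets of [gen {rho j | j != i}].              *)
Definition C_group (m : nat) (G : groupType) (rho : 'I_m -> G) : Prop :=
  [/\ gen (range rho) = [set: G],
      forall i, rho i <> 1 /\ rho i ^+ 2 = 1
    & forall I J : set 'I_m,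
        gen (rho @` I) `&` gen (rho @` J) = gen (rho @` (I `&` J))].

Definition string_C_group (m : nat) (G : groupType) (rho : 'I_m -> G) : Prop :=
  C_group rho /\
  forall i j : 'I_m, (i + 2 <= j)%N || (j + 2 <= i)%N ->
    (rho i * rho j) ^+ 2 = 1.

Definition schlafli_type (m : nat) (G : groupType) (rho : 'I_m -> G)
    (p : seq nat) : Prop :=
  (size p).+1 = m /\
  forall i j : 'I_m, j = i.+1 :> nat -> has_order (rho i * rho j) (nth 0 p i).

(* A presented group consists of words modulo the congruence generated by the *)
(* relators and by free cancellation.                                         *)
(* The letter [(i, b)] stands for the [i]-th generator, inverted if [b].      *)
Definition word (I : Type) : Type := seq (I * bool).

Definition inv_letter (I : Type) (l : I * bool) : I * bool := (l.1, ~~ l.2).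

Definition inv_word (I : Type) (w : word I) : word I :=
  rev (map (@inv_letter I) w).

Inductive word_eq (I : Type) (R : set (word I)) : word I -> word I -> Prop :=
| WordRefl u : word_eq R u u
| WordSym u v : word_eq R u v -> word_eq R v u
| WordTrans u v w : word_eq R u v -> word_eq R v w -> word_eq R u w
| WordCat u u' v v' :
    word_eq R u u' -> word_eq R v v' -> word_eq R (u ++ v) (u' ++ v')
| WordInv l : word_eq R [:: l; inv_letter l] [::]
| WordRel r : R r -> word_eq R r [::].

Section Presented.
Variables (I : choiceType) (R : set (word I)).
Implicit Types (u v w : seq (I * bool)).

Definition word_eqb u v : bool := `[< word_eq R u v >].

Lemma word_eqb_refl : reflexive word_eqb.
Proof. by move=> u; apply/asboolP; apply: WordRefl. Qed.

Lemma word_eqb_sym : symmetric word_eqb.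
Proof. by move=> u v; apply/asboolP/asboolP; apply: WordSym. Qed.

Lemma word_eqb_trans : transitive word_eqb.
Proof. by move=> v u w /asboolP uv /asboolP vw; apply/asboolP/(WordTrans uv). Qed.

Canonical word_equiv :=
  EquivRel word_eqb word_eqb_refl word_eqb_sym word_eqb_trans.

Definition presented : Type := {eq_quot word_equiv}.

HB.instance Definition _ := Choice.on presented.

Definition class_of_word (w : seq (I * bool)) : presented :=
  \pi_({eq_quot word_equiv}) w.
Definition word_of_class (x : presented) : seq (I * bool) :=
  @repr _ {eq_quot word_equiv} x.

Lemma word_of_classK x : class_of_word (word_of_class x) = x.
Proof. exact: (@reprK _ {eq_quot word_equiv}). Qed.

Lemma class_of_wordP u v :
  class_of_word u = class_of_word v <-> word_eq R u v.
Proof.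
split; first by move/eqmodP/asboolP.
by move=> uv; apply/eqmodP/asboolP.
Qed.

Lemma word_of_class_eq u : word_eq R (word_of_class (class_of_word u)) u.
Proof. by apply/class_of_wordP; rewrite word_of_classK. Qed.

Lemma word_eq_mulV w : word_eq R (w ++ inv_word w) [::].
Proof.
elim: w => [|l w IH]; first exact: WordRefl.
have -> : (l :: w) ++ inv_word (l :: w) =
          [:: l] ++ (w ++ inv_word w) ++ [:: inv_letter l].
  by rewrite /inv_word /= rev_cons -cats1 catA.
apply: (WordTrans (v := [:: l] ++ [::] ++ [:: inv_letter l])); last exact: WordInv.
by do 2![apply: WordCat => //; try exact: WordRefl].
Qed.

Lemma inv_wordK : involutive (@inv_word I).
Proof.
move=> w; rewrite /inv_word map_rev revK -map_comp -[RHS]map_id.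
by apply: eq_map => -[i b]; rewrite /inv_letter /= negbK.
Qed.

Lemma inv_word_cat u v : inv_word (u ++ v) = inv_word v ++ inv_word u.
Proof. by rewrite /inv_word map_cat rev_cat. Qed.

Lemma word_eq_mulVw w : word_eq R (inv_word w ++ w) [::].
Proof. by have := word_eq_mulV (inv_word w); rewrite inv_wordK. Qed.

Lemma word_eq_inv u v : word_eq R u v -> word_eq R (inv_word u) (inv_word v).
Proof.
move=> uv; apply: (WordTrans (v := inv_word u ++ (v ++ inv_word v))).
  rewrite -[X in word_eq R X _]cats0; apply: WordCat; first exact: WordRefl.
  exact/WordSym/word_eq_mulV.
rewrite catA -[X in word_eq R _ X]cat0s; apply: WordCat; last exact: WordRefl.
apply: WordTrans (word_eq_mulVw u); apply: WordCat; first exact: WordRefl.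
exact: WordSym.
Qed.

Definition pres_one : presented := class_of_word [::].
Definition pres_mul (x y : presented) : presented :=
  class_of_word (word_of_class x ++ word_of_class y).
Definition pres_inv (x : presented) : presented :=
  class_of_word (inv_word (word_of_class x)).

Lemma pres_mulE u v :
  pres_mul (class_of_word u) (class_of_word v) = class_of_word (u ++ v).
Proof. by apply/class_of_wordP; apply: WordCat; apply: word_of_class_eq. Qed.

Lemma pres_invE u : pres_inv (class_of_word u) = class_of_word (inv_word u).
Proof. by apply/class_of_wordP; apply/word_eq_inv/word_of_class_eq. Qed.

Lemma pres_mulA : associative pres_mul.
Proof.
move=> x y z; rewrite -[x]word_of_classK -[y]word_of_classK -[z]word_of_classK.
by rewrite !pres_mulE catA.
Qed.

Lemma pres_mul1 : left_id pres_one pres_mul.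
Proof. by move=> x; rewrite -[x]word_of_classK pres_mulE. Qed.

Lemma pres_mulr1 : right_id pres_one pres_mul.
Proof. by move=> x; rewrite -[x]word_of_classK pres_mulE cats0. Qed.

Lemma pres_mulV : left_inverse pres_one pres_inv pres_mul.
Proof.
move=> x; rewrite -[x]word_of_classK pres_invE pres_mulE.
exact/class_of_wordP/word_eq_mulVw.
Qed.

Lemma pres_mulrV : right_inverse pres_one pres_inv pres_mul.
Proof.
move=> x; rewrite -[x]word_of_classK pres_invE pres_mulE.
exact/class_of_wordP/word_eq_mulV.
Qed.

HB.instance Definition _ := isGroup.Build presented
  pres_mulA pres_mul1 pres_mulr1 pres_mulV pres_mulrV.

Definition pgen (i : I) : presented := class_of_word [:: (i, false)].

Lemma class_of_cat u v :
  class_of_word (u ++ v) = class_of_word u * class_of_word v.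
Proof. by rewrite -pres_mulE. Qed.

Lemma class_of_letter i b :
  class_of_word [:: (i, b)] = if b then (pgen i)^-1 else pgen i.
Proof. by case: b => //; rewrite /pgen; apply/esym; exact: pres_invE. Qed.

Section Eval.
Variables (H : groupType) (f : I -> H).

Definition eval_letter (l : I * bool) : H := if l.2 then (f l.1)^-1 else f l.1.

Fixpoint eval_word w : H := if w is l :: w' then eval_letter l * eval_word w' else 1.

Lemma eval_cat u v : eval_word (u ++ v) = eval_word u * eval_word v.
Proof. by elim: u => [|l u IH] /=; rewrite ?mul1g // IH mulgA. Qed.

Definition pres_eval (x : presented) : H := eval_word (word_of_class x).

Hypothesis fR : forall r, R r -> eval_word r = 1.

Lemma eval_word_eq u v : word_eq R u v -> eval_word u = eval_word v.
Proof.
elim=> {u v} [//|u v _ -> //|u v w _ -> _ -> //|u u' v v' _ IHu _ IHv|[i b]|r Rr].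
- by rewrite !eval_cat IHu IHv.
- by case: b; rewrite /eval_letter /= mulg1 ?mulgV ?mulVg.
- exact: fR.
Qed.

Lemma pres_eval_class w : pres_eval (class_of_word w) = eval_word w.
Proof. exact/eval_word_eq/word_of_class_eq. Qed.

Lemma pres_eval_gen i : pres_eval (pgen i) = f i.
Proof. by rewrite pres_eval_class /= mulg1. Qed.

Lemma pres_evalM : {morph pres_eval : x y / x * y}.
Proof.
move=> x y; rewrite -[x]word_of_classK -[y]word_of_classK -class_of_cat.
by rewrite !pres_eval_class eval_cat.
Qed.

End Eval.

Lemma eval_pgen w : eval_word pgen w = class_of_word w.
Proof.
by elim: w => //= -[i b] w ->; rewrite -cat1s class_of_cat class_of_letter.
Qed.

Lemma pres_morph_ext (H : groupType) (f g : presented -> H) :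
    {morph f : x y / x * y} -> {morph g : x y / x * y} ->
  (forall i, f (pgen i) = g (pgen i)) -> f =1 g.
Proof.
move=> fM gM fg x; rewrite -[x]word_of_classK.
have m1 (h : presented -> H) : {morph h : x y / x * y} -> h 1 = 1.
  by move=> hM; apply: (mulgI (h 1)); rewrite -hM !mulg1.
have mV (h : presented -> H) y : {morph h : x y / x * y} -> h y^-1 = (h y)^-1.
  by move=> hM; apply: (mulgI (h y)); rewrite -hM !mulgV m1.
elim: (word_of_class x) => [|[i b] w IH]; first by rewrite !m1.
rewrite -cat1s class_of_cat fM gM IH class_of_letter.
by case: b; rewrite ?mV ?fg.
Qed.

Lemma pres_commute (x : presented) :
  (forall i, commute x (pgen i)) -> forall y, commute x y.
Proof.
move=> xC y; have E : (fun z => x * z * x^-1) =1 id.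
  apply: pres_morph_ext => // [z t|i]; first by rewrite !mulgA mulgVK.
  by rewrite xC mulgK.
by rewrite /commute -[in RHS](E y) mulgVK.
Qed.

End Presented.

(* The relators [(i j)^(M i j)]; the diagonal entries of [M] are meant to be  *)
(* [1], which makes the generators involutions.                               *)
Definition coxeter_relators (I : Type) (M : I -> I -> nat) : set (word I) :=
  [set r | exists i j, r = flatten (nseq (M i j) [:: (i, false); (j, false)])].

Definition coxeter (I : choiceType) (M : I -> I -> nat) : groupType :=
  presented (coxeter_relators M).

Definition cgen (I : choiceType) (M : I -> I -> nat) (i : I) : coxeter M :=
  pgen (coxeter_relators M) i.

Lemma cgen_rel (I : choiceType) (M : I -> I -> nat) i j :
  (cgen M i * cgen M j) ^+ M i j = 1.
Proof.
have E k : class_of_word (coxeter_relators M)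
             (flatten (nseq k [:: (i, false); (j, false)])) =
           (cgen M i * cgen M j) ^+ k.
  elim: k => [|k IH]; first by rewrite expg0.
  rewrite expgS -IH -[flatten _]/([:: (i, false)] ++ [:: (j, false)] ++ _).
  by rewrite 2!class_of_cat mulgA.
by rewrite -E; apply/class_of_wordP/WordRel; exists i, j.
Qed.

Definition linear_matrix (p : seq nat) (i j : nat) : nat :=
  if i == j then 1%N
  else if (j == i.+1) || (i == j.+1) then nth 0 p (minn i j)
  else 2.

(* [linear_coxeter [:: p_1; ...; p_(m-1)]] is [p_1, ..., p_(m-1)], on [m]     *)
(* generators.                                                                *)
Definition linear_coxeter (p : seq nat) : groupType :=
  coxeter (fun i j : 'I_(size p).+1 => linear_matrix p i j).

Definition lgen (p : seq nat) (i : 'I_(size p).+1) : linear_coxeter p :=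
  cgen (fun i j : 'I_(size p).+1 => linear_matrix p i j) i.

(* Right action of [G] on [W] by group automorphisms.                         *)
Record gaction (G W : groupType) := GAction {
  gact :> W -> G -> W;
  gactM : forall g, {morph gact^~ g : u v / u * v};
  gact_1 : forall w, gact w 1 = w;
  gact_mul : forall w g h, gact w (g * h) = gact (gact w g) h }.

(* The pair [(g, w)] stands for the product [g w] in [W ><| G], so that       *)
(* [g^-1 w g = gact w g].                                                     *)
Definition semidirect (G W : groupType) (to : gaction G W) : Type := (G * W)%type.

Section Semidirect.
Variables (G W : groupType) (to : gaction G W).
Implicit Types x y : semidirect to.

HB.instance Definition _ := Choice.on (semidirect to).

Definition sd_one : semidirect to := (1, 1).
Definition sd_mul x y : semidirect to := (x.1 * y.1, to x.2 y.1 * y.2).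
Definition sd_inv x : semidirect to := (x.1^-1, (to x.2 x.1^-1)^-1).

Lemma gact1 g : to 1 g = 1.
Proof. by apply: (mulgI (to 1 g)); rewrite -gactM !mulg1. Qed.

Lemma gactV w g : to w^-1 g = (to w g)^-1.
Proof. by apply: (mulgI (to w g)); rewrite -gactM !mulgV gact1. Qed.

Lemma sd_mulA : associative sd_mul.
Proof. by move=> x y z; rewrite /sd_mul /= gactM gact_mul !mulgA. Qed.

Lemma sd_mul1 : left_id sd_one sd_mul.
Proof. by case=> g w; rewrite /sd_mul /= gact1 !mul1g. Qed.

Lemma sd_mulr1 : right_id sd_one sd_mul.
Proof. by case=> g w; rewrite /sd_mul /= gact_1 !mulg1. Qed.

Lemma sd_mulV : left_inverse sd_one sd_inv sd_mul.
Proof.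
by case=> g w; rewrite /sd_mul /= gactV -gact_mul !mulVg gact_1 mulVg.
Qed.

Lemma sd_mulrV : right_inverse sd_one sd_inv sd_mul.
Proof. by case=> g w; rewrite /sd_mul /= !mulgV. Qed.

HB.instance Definition _ := isGroup.Build (semidirect to)
  sd_mulA sd_mul1 sd_mulr1 sd_mulV sd_mulrV.

Definition sd_inl (w : W) : semidirect to := (1, w).
Definition sd_inr (g : G) : semidirect to := (g, 1).

Lemma sd_conj w g : sd_inl w ^ sd_inr g = sd_inl (to w g).
Proof.
rewrite conjgE.
rewrite -[LHS]/(sd_mul (sd_inv (sd_inr g)) (sd_mul (sd_inl w) (sd_inr g))).
by rewrite /sd_mul /= gactV !gact1 invg1 mulg1 !mul1g mulVg.
Qed.

End Semidirect.

(* The polytope [2^{P,G(s)}], for [P] of rank [n.+1] with group [G], generators *)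
(* [tau] and central involution [alpha].                                      *)
Section TwoP.
Variables (n : nat) (G : groupType) (tau : 'I_n.+1 -> G).

Definition vertex_stabilizer : set G := gen (tau @` [set j | j != ord0]).

Definition rtranslate (F : set G) (g : G) : set G := [set x * g | x in F].

Definition vertices : set (set G) :=
  [set rtranslate vertex_stabilizer g | g in [set: G]].

Lemma rtranslateM F g h : rtranslate F (g * h) = rtranslate (rtranslate F g) h.
Proof.
rewrite /rtranslate image_comp.
by congr (_ @` _); apply/funext => x /=; rewrite mulgA.
Qed.

Lemma rtranslate1 F : rtranslate F 1 = F.
Proof.
rewrite /rtranslate (_ : (fun x => x * 1) = id) ?image_id //.
by apply/funext => x; rewrite mulg1.
Qed.

Lemma vertices_translate (F : set G) g :
  F \in vertices -> rtranslate F g \in vertices.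
Proof.
move=> /set_mem[h _ <-]; apply/mem_set; exists (h * g) => //.
by rewrite rtranslateM.
Qed.

Lemma vertices_base : vertex_stabilizer \in vertices.
Proof. by apply/mem_set; exists 1 => //; exact: rtranslate1. Qed.

Definition base_vertex : vertices :=
  exist (fun F => F \in vertices) _ vertices_base.

Definition vtrans (F : vertices) (g : G) : vertices :=
  exist (fun E => E \in vertices) _ (vertices_translate g (valP F)).

Lemma vtrans1 F : vtrans F 1 = F.
Proof. by apply: val_inj; rewrite /= rtranslate1. Qed.

Lemma vtransM F g h : vtrans F (g * h) = vtrans (vtrans F g) h.
Proof. by apply: val_inj; rewrite /= rtranslateM. Qed.

Lemma vtrans_inj g : injective (vtrans^~ g).
Proof.
move=> E F /(congr1 (vtrans^~ g^-1)).
by rewrite -!vtransM mulgV !vtrans1.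
Qed.

Variables (alpha : G) (s : nat).

Definition antipodal_matrix (E F : vertices) : nat :=
  if E == F then 1%N else if F == vtrans E alpha then s else 2.

Definition two_W : groupType := coxeter antipodal_matrix.

Definition sigma (F : vertices) : two_W := cgen antipodal_matrix F.

Definition two_act (w : two_W) (g : G) : two_W :=
  pres_eval (fun F => sigma (vtrans F g)) w.

Hypothesis alphaC : forall g, commute alpha g.

Lemma antipodal_matrix_trans g E F :
  antipodal_matrix (vtrans E g) (vtrans F g) = antipodal_matrix E F.
Proof.
rewrite /antipodal_matrix (inj_eq (@vtrans_inj g)) -vtransM -alphaC vtransM.
by rewrite (inj_eq (@vtrans_inj g)).
Qed.

Lemma two_act_relators g r : coxeter_relators antipodal_matrix r ->
  eval_word (fun F => sigma (vtrans F g)) r = 1.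
Proof.
case=> E [F ->].
pose m w := [seq (vtrans l.1 g, l.2) | l <- w] : seq (vertices * bool).
have -> w : eval_word (fun F => sigma (vtrans F g)) w =
            class_of_word (coxeter_relators antipodal_matrix) (m w).
  by rewrite -eval_pgen; elim: w => //= l w ->.
apply/class_of_wordP/WordRel; exists (vtrans E g), (vtrans F g).
by rewrite antipodal_matrix_trans /m map_flatten map_nseq.
Qed.

Lemma two_act_gen g F : two_act (sigma F) g = sigma (vtrans F g).
Proof. exact: (pres_eval_gen (@two_act_relators g)). Qed.

Lemma two_actM g : {morph two_act^~ g : u v / u * v}.
Proof. exact: (pres_evalM (@two_act_relators g)). Qed.

Lemma two_act1 w : two_act w 1 = w.
Proof.
apply: (pres_morph_ext (g := id) (two_actM 1)) => // F.
by rewrite [LHS]two_act_gen vtrans1.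
Qed.

Lemma two_act_mul w g h : two_act w (g * h) = two_act (two_act w g) h.
Proof.
apply: (pres_morph_ext (f := two_act^~ (g * h))
                       (g := fun u => two_act (two_act u g) h)) => [||F].
- exact: two_actM.
- by move=> u v; rewrite !two_actM.
- by rewrite [LHS]two_act_gen [X in two_act X h]two_act_gen two_act_gen vtransM.
Qed.

Definition two_action : gaction G two_W :=
  GAction two_actM two_act1 two_act_mul.

Definition two_group : groupType := semidirect two_action.

Definition two_rho (i : 'I_n.+2) : two_group :=
  if unlift ord0 i is Some j then sd_inr two_action (tau j)
  else sd_inl two_action (sigma base_vertex).

End TwoP.

Definition cell600_group : groupType := linear_coxeter [:: 3; 3; 5].

Definition cell600_tau : 'I_4 -> cell600_group := @lgen [:: 3; 3; 5].

Definition cell600_alpha : cell600_group :=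
  (cell600_tau (inord 0) * cell600_tau (inord 1) *
   cell600_tau (inord 2) * cell600_tau (inord 3)) ^+ 15.

(* Centrality of [cell600_alpha], by computation with words.  If              *)
(* [braid_head k a w] is [Some u], then [w] and [a :: u] represent the same   *)
(* element, as witnessed by braid moves.                                      *)
Section Central.

Notation m600 := (linear_matrix [:: 3; 3; 5]).
Implicit Types (a b : 'I_4) (u v w : seq 'I_4).

Fixpoint alternating (k : nat) a b : seq 'I_4 :=
  if k is k'.+1 then a :: alternating k' b a else [::].

Fixpoint strip_alternating (head : 'I_4 -> seq 'I_4 -> option (seq 'I_4))
    (k : nat) a b w : option (seq 'I_4) :=
  if k isn't k'.+1 then Some w else
  if head a w is Some u then strip_alternating head k' b a u else None.

Fixpoint braid_head (fuel : nat) a w : option (seq 'I_4) :=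
  if fuel isn't k.+1 then None else
  if w isn't b :: w' then None else
  if a == b then Some w' else
  if strip_alternating (braid_head k) (m600 a b).-1 a b w' is Some u
  then Some (alternating (m600 a b).-1 b a ++ u) else None.

Fixpoint strip_word v w : bool :=
  if v is a :: v' then
    if braid_head 100 a w is Some u then strip_word v' u else false
  else w == [::].

Definition o4 k (kP : (k < 4)%N) : 'I_4 := Ordinal kP.

Definition alpha_word : seq 'I_4 :=
  flatten (nseq 15 [:: @o4 0 isT; @o4 1 isT; @o4 2 isT; @o4 3 isT]).

Definition central_check a : bool :=
  if braid_head 100 a alpha_word is Some u
  then strip_word alpha_word (rcons u a) else false.

Definition ev600 w : cell600_group := \prod_(a <- w) cell600_tau a.

Lemma ev600_cons a w : ev600 (a :: w) = cell600_tau a * ev600 w.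
Proof. by rewrite /ev600 big_cons. Qed.

Lemma ev600_cat v w : ev600 (v ++ w) = ev600 v * ev600 w.
Proof. by rewrite /ev600 big_cat. Qed.

Lemma tau600_rel a b : (cell600_tau a * cell600_tau b) ^+ m600 a b = 1.
Proof. exact: (cgen_rel (fun i j : 'I_4 => m600 i j)). Qed.

Lemma tau600_inv a : (cell600_tau a)^-1 = cell600_tau a.
Proof.
have := tau600_rel a a; rewrite /linear_matrix eqxx expg1 => h.
by apply: (mulgI (cell600_tau a)); rewrite h mulgV.
Qed.

Lemma ev600_alternating k a b :
  ev600 (alternating k a b) * (ev600 (alternating k b a))^-1 =
  (cell600_tau a * cell600_tau b) ^+ k.
Proof.
elim: k a b => [|k IH] a b; first by rewrite /ev600 !big_nil mulgV expg0.
rewrite /= !ev600_cons invMg tau600_inv mulgA -(mulgA (cell600_tau a)) IH.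
elim: k {IH} => [|k IH]; first by rewrite !expg0 mulg1 expg1.
by rewrite expgS [RHS]expgS -IH !mulgA.
Qed.

Lemma m600_gt0 a b : (0 < m600 a b)%N.
Proof. by move: a b; do 2![case=> -[|[|[|[|]]]] //= ?]. Qed.

Lemma ev600_braid a b :
  ev600 (alternating (m600 a b) a b) = ev600 (alternating (m600 a b) b a).
Proof.
have := ev600_alternating (m600 a b) a b; rewrite tau600_rel => h.
by rewrite -[LHS](mulgVK (ev600 (alternating (m600 a b) b a))) h mul1g.
Qed.

Lemma strip_alternatingP head k a b w u :
    (forall c v v', head c v = Some v' -> ev600 v = cell600_tau c * ev600 v') ->
  strip_alternating head k a b w = Some u ->
  ev600 w = ev600 (alternating k a b) * ev600 u.
Proof.
move=> headP; elim: k a b w => [|k IH] a b w /=.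
  by case=> ->; rewrite /ev600 big_nil mul1g.
case E: (head a w) => [v|] // /IH E'.
by rewrite (headP _ _ _ E) E' ev600_cons mulgA.
Qed.

Lemma braid_headP k a w u :
  braid_head k a w = Some u -> ev600 w = cell600_tau a * ev600 u.
Proof.
elim: k a w u => [|k IH] a [|b w] u //=.
case: eqVneq => [-> [->]|_]; first by rewrite ev600_cons.
case E: strip_alternating => [v|] // [<-].
rewrite ev600_cons (strip_alternatingP IH E) ev600_cat !mulgA -!ev600_cons.
have := ev600_braid a b; rewrite -(prednK (m600_gt0 a b)) /= => ->.
by [].
Qed.

Local Arguments braid_head : simpl never.

Lemma strip_wordP v w : strip_word v w -> ev600 w = ev600 v.
Proof.
elim: v w => [|a v IH] w /=; first by move/eqP->.
by case E: (braid_head 100 a w) => [u|] //= /IH uv; rewrite (braid_headP E) uv ev600_cons.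
Qed.

Lemma central_checkT a : central_check a.
Proof.
have -> : a = nth a [:: @o4 0 isT; @o4 1 isT; @o4 2 isT; @o4 3 isT] a.
  by apply: val_inj; case: a => -[|[|[|[|]]]].
by case: a => -[|[|[|[|]]]] //= _; vm_compute.
Qed.

Lemma cell600_alphaE : cell600_alpha = ev600 alpha_word.
Proof.
have inordE k (kP : (k < 4)%N) : inord k = o4 kP :> 'I_4.
  by apply: val_inj; rewrite /= inordK.
rewrite /cell600_alpha (inordE 0%N isT) (inordE 1%N isT) (inordE 2 isT).
rewrite (inordE 3 isT) /alpha_word; elim: 15 => [|k IH].
  by rewrite expg0 /ev600 big_nil.
by rewrite expgS IH /= !ev600_cons !mulgA.
Qed.

Lemma cell600_alpha_gen a : commute cell600_alpha (cell600_tau a).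
Proof.
rewrite /commute cell600_alphaE; have := central_checkT a; rewrite /central_check.
case E: braid_head => [u|] // /strip_wordP.
rewrite (braid_headP E) -cats1 ev600_cat ev600_cons {2}/ev600 big_nil mulg1.
move=> h; rewrite -[LHS]mulgA h; congr (_ * _); exact: esym.
Qed.

Lemma cell600_alpha_central g : commute cell600_alpha g.
Proof.
by apply: pres_commute => a; apply: cell600_alpha_gen.
Qed.

End Central.

Definition cell600_two_W (s : nat) : groupType :=
  two_W cell600_tau cell600_alpha s.

(* Definitionally [cell600_two_W s ><| cell600_group].                        *)
Definition cell600_two_group (s : nat) : groupType :=
  two_group cell600_tau s cell600_alpha_central.

Definition cell600_two_rho (s : nat) : 'I_5 -> cell600_two_group s :=
  two_rho cell600_tau s cell600_alpha_central.

(* The additional relators, in [linear_coxeter [:: 4; 3; 3; 5]].              *)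
Definition cell600_two_relators (s : nat) : set (linear_coxeter [:: 4; 3; 3; 5]) :=
  let r (k : nat) := @lgen [:: 4; 3; 3; 5] (inord k) in
  let b := r 1%N * r 2 * r 3 * r 4 in
  [set (r 0%N * b ^- i * r 0%N * b ^+ i) ^+ 2 | i in [set` [:: 4; 6; 7; 9; 10; 12]]]
  `|` [set (r 0%N * b ^+ 15 * r 0%N * b ^+ 15) ^+ s].

(* Main.v *)
From HB Require Import structures.
Require Import Defs.
From mathcomp Require Import all_boot all_fingroup all_solvable all_algebra zify.
From mathcomp Require Import boolp classical_sets functions cardinality.

(** The group of the polytope is the semidirect product of the group W, generated
    by one involution for each vertex of the 600-cell, by G = [3,3,5].  All that
    is needed about G comes from its action on the orbit of a fundamental
    weight.  In the basis of fundamental weights the simple reflections act on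
    vectors with coordinates in Z[phi], phi the golden ratio
    ([reflect600_relators]).  The orbit of the first weight has 120 elements,
    its stabilizer is generated by the last three reflections, and so the orbit
    is a concrete copy of the vertex set ([vertex_weight_inj]) on which the
    central involution acts as -1 ([vertex_weight_alpha]).  The stabilizer is
    found by the Schreier method ([schreier_okT], [segment_stab]): a spanning
    tree of the orbit labels each point with a word, and every edge outside the
    tree is checked, inside the presented group, to give an element of the
    subgroup.  The same is done for all parabolic subgroups generated by
    consecutive reflections, acting on the orbit of a vertex of the base
    tetrahedron; the chain 120, 12, 5, 2 of orbit lengths gives the order 14400
    of G.

    Intersection property.  For a string of involutions it is enough to compare
    subgroups generated by consecutive generators ([gen_facets]).  In G, the
    generators of index at least j fix the first j vertices of the base
    tetrahedron, and an element of a consecutive parabolic subgroup that fixes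
    the next vertex drops the next generator ([segment600I]).  In the semidirect
    product, an intersection with a subgroup that omits the first generator
    takes place inside G ([segment_two_I]).

    The group W.  Antipodality pairs the 120 vertices into 60 axes, generators
    of different axes commute, and those of one axis generate a dihedral group.
    Hence every element of W is a product over the axes of the 2s normal forms
    of dihedral elements, and mapping W to the product of 60 dihedral groups of
    order 2s separates these products ([dihedral_power]).

    Presentation.  A semidirect product of this kind is presented by the
    relations of G, by the commutation of the first generator with the vertex
    stabilizer H, and by the relations of W between the base vertex and one
    vertex in each H-orbit.  There are nine H-orbits, of lengths 1, 12, 20, 12,
    30, 12, 20, 12, 1, and they are represented by the identity, the first
    reflection and the powers 4, 6, 7, 9, 10, 12, 15 of the Coxeter element
    ([double_coset_ind]).  The identity is covered by the involution relation,
    the first reflection by the entry 4 of the diagram and the powers by the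
    additional relators, so any group with the stated relations receives a
    morphism from the semidirect product ([universal_two_group]).  Applied to the
    presented quotient itself, it shows that the kernel is no larger than the
    normal closure of the relators ([preim1_normal_closure]). *)

Set Implicit Arguments.
Unset Strict Implicit.
Unset Printing Implicit Defensive.

Local Open Scope classical_set_scope.
Local Open Scope group_scope.

Local Notation tau600 := cell600_tau.
Local Notation vert600 := (vertices cell600_tau).
Local Notation base600 := (base_vertex cell600_tau).

(** * Generated subgroups, involutions and orders *)

Section Gen.
Variable G : groupType.
Implicit Types (A : set G) (x y : G).

Lemma gen_subgroup A : subgroup (gen A).
Proof.
split=> [S [[] //]|x y Ax Ay S SA|x Ax S SA].
- by have [[_ SM _] _] := SA; apply: SM; [apply: Ax|apply: Ay].
- by have [[_ _ SV] _] := SA; apply: SV; apply: Ax.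
Qed.

Lemma gen_one A : gen A 1. Proof. by have [] := gen_subgroup A. Qed.

Lemma gen_mul A x y : gen A x -> gen A y -> gen A (x * y).
Proof. by have [_ + _] := gen_subgroup A; apply. Qed.

Lemma gen_inv A x : gen A x -> gen A x^-1.
Proof. by have [_ _] := gen_subgroup A; apply. Qed.

Lemma gen_cancell A x y : gen A x -> gen A (x * y) -> gen A y.
Proof. by move=> /gen_inv Ax /(gen_mul Ax); rewrite mulKg. Qed.

Lemma gen_cancelr A x y : gen A y -> gen A (x * y) -> gen A x.
Proof. by move=> /gen_inv Ay /gen_mul/(_ Ay); rewrite mulgK. Qed.

Lemma sub_gen A : A `<=` gen A.
Proof. by move=> x Ax S [_]; apply. Qed.

Variables (I : eqType) (rho : I -> G).
Implicit Type J : set I.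

Lemma gen_image i J : J i -> gen (rho @` J) (rho i).
Proof. by move=> Ji; apply: sub_gen; exists i. Qed.

Lemma gen_mono J K : J `<=` K -> gen (rho @` J) `<=` gen (rho @` K).
Proof.
move=> JK x Jx; apply: Jx; split; first exact: gen_subgroup.
by move=> _ [i /JK Ki <-]; apply: gen_image.
Qed.

Hypothesis rho2 : forall i, rho i * rho i = 1.

Lemma rhoV i : (rho i)^-1 = rho i.
Proof. by apply: (mulgI (rho i)); rewrite rho2 mulgV. Qed.

Lemma gen_words J x : gen (rho @` J) x ->
  exists2 w : seq I, (forall i, i \in w -> J i) & x = \prod_(i <- w) rho i.
Proof.
move=> Jx; apply: (Jx [set x | exists2 w : seq I, forall i, i \in w -> J i &
                         x = \prod_(i <- w) rho i]); split.
- split=> [|_ _ [v Jv ->] [w Jw ->]|_ [w Jw ->]].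
  + by exists [::] => //; rewrite big_nil.
  + exists (v ++ w); last by rewrite big_cat.
    by move=> i; rewrite mem_cat => /orP[/Jv|/Jw].
  + exists (rev w); first by move=> i; rewrite mem_rev => /Jw.
    elim: w {Jw} => [|i w IH]; first by rewrite !big_nil invg1.
    by rewrite rev_cons -cats1 big_cat big_seq1 big_cons invMg IH rhoV.
- move=> _ [i Ji <-]; exists [:: i]; last by rewrite big_seq1.
  by move=> j; rewrite inE => /eqP ->.
Qed.

(** Since the generators are their own inverses, subgroup elements are words without
    inverse letters, so that right multiplication by a generator is the only step. *)
Lemma gen_ind J (P : G -> Prop) : P 1 ->
    (forall x i, gen (rho @` J) x -> P x -> J i -> P (x * rho i)) ->
  forall x, gen (rho @` J) x -> P x.
Proof.
move=> P1 PM x /gen_words[w Jw ->].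
suff [] : gen (rho @` J) (\prod_(i <- w) rho i) /\ P (\prod_(i <- w) rho i) by [].
elim/last_ind: w Jw => [|w i IH] Jw.
  by rewrite big_nil; split => //; apply: gen_one.
have Ji : J i by apply: Jw; rewrite mem_rcons mem_head.
have [|gw Pw] := IH; first by move=> j wj; apply: Jw; rewrite mem_rcons inE wj orbT.
rewrite -cats1 big_cat big_seq1; split; last exact: PM.
by apply: gen_mul => //; apply: gen_image.
Qed.

End Gen.

Definition multiplicative_of (G H : groupType) (f : G -> H)
    (fM : {morph f : x y / x * y}) : {multiplicative G -> H} :=
  HB.pack f (isMultiplicative.Build G H f fM).

Section Morphisms.
Variables (G H : groupType) (f : G -> H).
Hypothesis fM : {morph f : x y / x * y}.

Lemma morph_one : f 1 = 1.
Proof. by apply: (mulgI (f 1)); rewrite -fM !mulg1. Qed.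

Lemma morph_inv x : f x^-1 = (f x)^-1.
Proof. by apply: (mulgI (f x)); rewrite -fM !mulgV morph_one. Qed.

Lemma morph_exp x n : f (x ^+ n) = f x ^+ n.
Proof. by elim: n => [|n IH]; rewrite ?expg0 ?morph_one // !expgS fM IH. Qed.

Lemma morph_conj x y : f (x ^ y) = f x ^ f y.
Proof. by rewrite !conjgE !fM morph_inv. Qed.

End Morphisms.

(** The hypothesis says that x * y is its own inverse, and for involutions that inverse is
    y * x. *)
Lemma commute_involutions (G : groupType) (x y : G) :
  x * x = 1 -> y * y = 1 -> (x * y) ^+ 2 = 1 -> commute x y.
Proof.
move=> x2 y2; rewrite expgS expg1 => xy2.
apply: (mulgI (x * y)); rewrite xy2 -mulgA (mulgA y y) y2 mul1g x2 //.
Qed.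

(** The products of two involutions in the two orders are inverse to each other. *)
Lemma mulg_involutions_exp (G : groupType) (x y : G) k :
  x * x = 1 -> y * y = 1 -> (x * y) ^+ k = 1 -> (y * x) ^+ k = 1.
Proof.
move=> x2 y2 xyk; have -> : y * x = (x * y)^-1.
  by apply: (mulgI (x * y)); rewrite mulgV -mulgA (mulgA y) y2 mul1g x2.
by rewrite expgVn xyk invg1.
Qed.

(** In a product over distinct indices, a factor that commutes with all terms but one
    can be absorbed by that term, although the group is not commutative. *)
Lemma prod_mul_commute (G : groupType) (I : eqType) (r : seq I) (F : I -> G) j x :
    uniq r -> j \in r -> (forall i, i != j -> commute (F i) x) ->
  (\prod_(i <- r) F i) * x = \prod_(i <- r) (if i == j then F i * x else F i).
Proof.
move=> + + Fx; elim: r => //= i r IH /andP[ir r_uniq].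
rewrite inE !big_cons; case: (eqVneq j i) => [ji _|ij /= jr]; last first.
  by rewrite -mulgA IH.
subst i; rewrite -!mulgA; congr (_ * _).
have -> : \prod_(k <- r) (if k == j then F k * x else F k) = \prod_(k <- r) F k.
  by apply: eq_big_seq => k kr; case: eqVneq => // kj; rewrite -kj kr in ir.
apply: commute_sym; rewrite big_seq; apply: commute_prod => k kr.
by apply: commute_sym; apply: Fx; apply: contraNneq ir => <-.
Qed.

Lemma mulg_conjg (G : groupType) (x y z : G) : x * y ^ z = x * z^-1 * y * z.
Proof. by rewrite conjgE !mulgA. Qed.

Lemma coprime_expg_eq1 (G : groupType) (x : G) j k :
  (0 < j)%N -> coprime j k -> x ^+ j = 1 -> x ^+ k = 1 -> x = 1.
Proof.
move=> j0 jk xj xk; have := egcdnP k j0.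
case=> u v uv _; move: jk => /eqP jk.
have : x ^+ (u * j) = x ^+ (v * k + 1) by rewrite uv jk.
by rewrite mulnC expgM xj expg1n mulnC expgnDr expgM xk expg1n mul1g expg1.
Qed.

Lemma has_order_prime (G : groupType) (x : G) p :
  prime p -> x ^+ p = 1 -> x <> 1 -> has_order x p.
Proof.
move=> p_pr xp x1; split=> [||j /andP[j0 jp] xj] //; first exact: prime_gt0.
apply: x1; apply: (coprime_expg_eq1 j0 _ xj xp).
by rewrite coprime_sym prime_coprime // gtnNdvd //.
Qed.

Lemma has_order4 (G : groupType) (x : G) : x ^+ 4 = 1 -> x ^+ 2 <> 1 -> has_order x 4.
Proof.
move=> x4 x2; split=> // -[|[|[|[|//]]]] // _ xj; apply: x2.
  by rewrite (_ : x = 1) ?expg1n.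
by rewrite (coprime_expg_eq1 (j := 3) _ _ xj x4) ?expg1n.
Qed.

(** * Intersections in groups generated by a string of involutions *)

Section StringCriterion.
Variables (m : nat) (G : groupType) (rho : 'I_m -> G).

Definition segment (a b : nat) : set G := gen (rho @` [set k : 'I_m | (a <= k < b)%N]).

Hypothesis rho2 : forall i, rho i * rho i = 1.
Hypothesis rhoC : forall i j : 'I_m, (i + 2 <= j)%N -> commute (rho i) (rho j).

(** Indices on the two sides of a gap differ by at least 2. *)
Lemma segment_commute (i a b : nat) (k : 'I_m) x :
  (k < i)%N -> (i < a)%N -> segment a b x -> commute (rho k) x.
Proof.
move=> ki ia; apply: gen_ind => // [|y j _ ky /= /andP[aj _]].
  exact: commute1.
by apply: commuteM => //; apply: rhoC; rewrite addn2 (leq_trans _ aj) // (leq_ltn_trans ki).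
Qed.

(** Removing the generator of index i splits the diagram into two parts that commute,
    so the subgroup is the product of the two segments. *)
Lemma facet_factor (i : 'I_m) x : gen (rho @` [set k | k != i]) x ->
  exists a c, [/\ segment 0 i a, segment i.+1 m c & x = a * c].
Proof.
move: x; apply: gen_ind => // [|x k _ [a [c [Aa Cc ->]]] /= ki].
  by exists 1, 1; rewrite mulg1; split; rewrite //; apply: gen_one.
move: ki; rewrite -val_eqE neq_ltn => /orP[ki|ik].
  exists (a * rho k), c; split => //.
    by apply: gen_mul => //; apply: gen_image.
  by rewrite -!mulgA (segment_commute ki _ Cc).
exists a, (c * rho k); rewrite mulgA; split => //.
by apply: gen_mul => //; apply: gen_image; rewrite /= ik ltn_ord.
Qed.

Hypothesis segmentI : forall j i x, (j <= i <= m)%N ->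
  segment 0 i x -> segment j m x -> segment j i x.

(** Every subgroup generated by a subset I is the intersection of the maximal ones that
    contain it.  If i is the first index outside I, from j on, an element x of the segment
    that starts at j factors as x = a * c at i.  The factor a = x * c^-1 lies
    in both segments [0, i) and [j, m), hence in [j, i), all of whose generators belong to I.
    The factor c lies in a shorter segment, and induction applies. *)
Lemma gen_facets (I : set 'I_m) x :
  (forall i, ~ I i -> gen (rho @` [set k | k != i]) x) ->
  gen (rho @` [set: 'I_m]) x -> gen (rho @` I) x.
Proof.
move=> xM xT.
(* Induction on the length m - j of the remaining segment; for j = 0 it is the whole
   group. *)
suff claim n j y : (m - j <= n)%N -> segment j m y ->
    (forall i, ~ I i -> gen (rho @` [set k | k != i]) y) -> gen (rho @` I) y.
  apply: (claim m 0%N) => //; first by rewrite subn0.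
  by apply: gen_mono xT => i _ /=; apply: ltn_ord.
elim: n j y => [|n IH] j y.
  rewrite leqn0 subn_eq0 => mj jy _; apply: gen_mono jy => k /= /andP[jk].
  by rewrite ltnNge (leq_trans mj jk).
move=> jn jy yM.
have [jI|] := pselect (forall k : 'I_m, (j <= k)%N -> I k).
  by apply: gen_mono jy => k /= /andP[jk _]; apply: jI.
move/existsNP => [i0 /not_implyP[ji0 nI0]].
pose p (k : 'I_m) := (j <= k)%N && ~~ `[< I k >].
have p0 : p i0 by rewrite /p ji0; apply/asboolPn.
have [i /andP[ji /asboolPn nIi] imin] := arg_minnP (fun k : 'I_m => k : nat) p0.
have [a [c [aA cC yE]]] := facet_factor (yM i nIi).
have jc : segment j m c.
  by apply: gen_mono cC => k /= /andP[ik ->]; rewrite (leq_trans ji) // ltnW.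
have ja : segment j m a by apply: (gen_cancelr jc); rewrite -yE.
have aI : gen (rho @` I) a.
  have jia : segment j i a by apply: segmentI => //; rewrite ji ltnW.
  apply: gen_mono jia => k /= /andP[jk ki]; apply: contrapT => nIk.
  by have := imin k; rewrite /p jk /= leqNgt ki => /(_ (introT (asboolPn _) nIk)).
rewrite yE; apply: gen_mul => //; apply: (IH i.+1) => //.
  by have := ltn_ord i; lia.
move=> k nIk; apply: (gen_cancell (x := a)); last by rewrite -yE; apply: yM.
by apply: gen_mono aI => l /= Il; apply/eqP => lk; apply: nIk; rewrite -lk.
Qed.

(** With every subgroup an intersection of maximal ones, intersecting two of them unites
    their families of maximal subgroups, which are those that contain the generators in
    common. *)
Lemma string_C_groupI : gen (range rho) = [set: G] ->
    (forall i, rho i <> 1) -> string_C_group rho.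
Proof.
move=> rhoT rho1; split; [split=> //|].
- by move=> i; split => //; rewrite expgS expg1.
- move=> I J; rewrite eqEsubset; split; last first.
    by move=> x IJx; split; apply: gen_mono IJx => k [].
  move=> x [Ix Jx]; apply: gen_facets; last by rewrite rhoT.
  move=> i /not_andP[nI|nJ].
    by apply: gen_mono Ix => k /= Ik; apply/eqP => ki; apply: nI; rewrite -ki.
  by apply: gen_mono Jx => k /= Jk; apply/eqP => ki; apply: nJ; rewrite -ki.
- move=> i j /orP[ij|ij].
    by rewrite expgS expg1 {1}(rhoC ij) -mulgA (mulgA (rho i)) rho2 mul1g.
  by rewrite expgS expg1 -{1}(rhoC ij) -mulgA (mulgA (rho i)) rho2 mul1g.
Qed.

End StringCriterion.

(** * Presented groups: morphisms, actions, quotients *)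

Section PresentedLemmas.
Variables (I : choiceType) (R : set (word I)).

Lemma gen_pgen : gen (range (pgen R)) = [set: presented R].
Proof.
rewrite eqEsubset; split=> // x _; rewrite -[x]word_of_classK.
elim: (word_of_class x) => [|[i b] w IH]; first exact: gen_one.
rewrite -cat1s class_of_cat; apply: gen_mul IH; rewrite class_of_letter.
have gi : gen (range (pgen R)) (pgen R i) by apply: gen_image.
by case: b => //=; apply: gen_inv.
Qed.

Lemma pres_ind (P : presented R -> Prop) :
    (forall i, pgen R i * pgen R i = 1) ->
    P 1 -> (forall x i, P x -> P (x * pgen R i)) ->
  forall x, P x.
Proof.
move=> R2 P1 PM x; have : gen (range (pgen R)) x by rewrite gen_pgen.
by move: x; apply: gen_ind => // x i _ Px _; apply: PM.
Qed.

End PresentedLemmas.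

(** The universal property of a Coxeter group. *)
Lemma coxeter_eval (I : choiceType) (M : I -> I -> nat) (H : groupType) (f : I -> H) :
    (forall i j, (f i * f j) ^+ M i j = 1) ->
  exists phi : {multiplicative coxeter M -> H}, forall i, phi (cgen M i) = f i.
Proof.
move=> fM; have rel r : coxeter_relators M r -> eval_word f r = 1.
  case=> i [j ->]; rewrite -[RHS](fM i j); move: (M i j) => k.
  by elim: k => //= k ->; rewrite /eval_letter /= mulgA expgS.
by exists (multiplicative_of (pres_evalM rel)) => i; apply: pres_eval_gen.
Qed.

Section PresentedQuotient.
Variables (I : choiceType) (R : set (word I)) (A : set (presented R)).

(** Adding to the relators all words that represent an element of A presents the quotient
    by the normal closure of A. *)
Definition quotient_relators : set (word I) :=
  R `|` [set w | A (class_of_word R w)].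

Lemma normal_closure_normal : normal_subgroup (normal_closure A).
Proof.
split; first split=> [S [[[] //]]|x y Ax Ay S SA|x Ax S SA].
- by have [[[_ SM _] _] _] := SA; apply: SM; [apply: Ax|apply: Ay].
- by have [[[_ _ SV] _] _] := SA; apply: SV; apply: Ax.
- by move=> x g Ax S SA; have [[_ SJ] _] := SA; apply: SJ; apply: Ax.
Qed.

(** Each rule that generates the congruence of the larger presentation holds modulo the
    normal closure; for concatenation this is its normality. *)
Lemma word_eq_normal_closure u v : word_eq quotient_relators u v ->
  normal_closure A (class_of_word R u * (class_of_word R v)^-1).
Proof.
have [[N1 NM NV] NJ] := normal_closure_normal.
elim=> {u v} [u|u v _ IH|u v w _ IHuv _ IHvw|u u' v v' _ IHu _ IHv|l|u].
- by rewrite mulgV.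
- by rewrite -[_ * _^-1]invgK invMg invgK; apply: NV.
- by have := NM _ _ IHuv IHvw; rewrite mulgA mulgVK.
- rewrite !class_of_cat invMg.
  have := NM _ _ (NJ _ (class_of_word R u)^-1 IHv) IHu.
  by rewrite conjgE invgK !mulgA mulgVK.
- rewrite (_ : class_of_word R [:: l; _] = class_of_word R [::]) ?mulgV //.
  by apply/class_of_wordP; apply: WordInv.
- have c1 : class_of_word R [::] = 1 by [].
  case=> [Ru|Au]; rewrite c1 invg1 mulg1; last by move=> S [_ SA]; apply: SA.
  rewrite (_ : class_of_word R u = 1) // -c1.
  by apply/class_of_wordP; apply: WordRel.
Qed.

Lemma quotient_morphism :
  exists q : {multiplicative presented R -> presented quotient_relators},
    forall w, q (class_of_word R w) = class_of_word quotient_relators w.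
Proof.
pose q := pres_eval (R := R) (pgen quotient_relators).
have q_class w : q (class_of_word R w) = class_of_word quotient_relators w.
  rewrite /q pres_eval_class ?eval_pgen // => r Rr.
  by rewrite eval_pgen; apply/class_of_wordP; apply: WordRel; left.
have qM : {morph q : y z / y * z}.
  move=> y z; rewrite -[y]word_of_classK -[z]word_of_classK -class_of_cat.
  by rewrite !q_class class_of_cat.
by exists (multiplicative_of qM).
Qed.

Variable q : {multiplicative presented R -> presented quotient_relators}.
Hypothesis q_class : forall w, q (class_of_word R w) = class_of_word quotient_relators w.

Lemma quotient_morphism_kill a : A a -> q a = 1.
Proof.
move=> Aa; rewrite -[a]word_of_classK q_class; apply/class_of_wordP.
by apply: WordRel; right; rewrite /= word_of_classK.
Qed.

(** A morphism g back to the presented quotient, compatible with the generators, shows that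
    f identifies no more elements than the quotient does. *)
Lemma preim1_normal_closure (H : groupType) (f : {multiplicative presented R -> H})
    (g : {multiplicative H -> presented quotient_relators}) :
    (forall a, A a -> f a = 1) -> (forall i, g (f (pgen R i)) = pgen quotient_relators i) ->
  f @^-1` [set 1] = normal_closure A.
Proof.
move=> fA gf; have fM : {morph f : y z / y * z} by exact: gmulfM.
have gM : {morph g : y z / y * z} by exact: gmulfM.
apply/seteqP; split=> x /=; last first.
  move=> /(_ (f @^-1` [set 1])); apply; split; last by move=> y /fA.
  split; first split=> [|y z /= fy fz|y /= fy].
  - by rewrite /= (morph_one fM).
  - by rewrite gmulfM fy fz mulg1.
  - by rewrite (morph_inv fM) fy invg1.
  - by move=> y z /= fy; rewrite (morph_conj fM) fy conj1g.
move=> fx; have : q x = 1.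
  have -> : q x = g (f x).
    apply: (pres_morph_ext (f := q) (g := g \o f)) => [|y z|i] /=.
    - exact: gmulfM.
    - by rewrite fM gM.
    - by rewrite gf [LHS]q_class.
  by rewrite fx (morph_one gM).
rewrite -[x]word_of_classK q_class => /class_of_wordP/word_eq_normal_closure.
by rewrite (_ : class_of_word R [::] = 1) // invg1 mulg1.
Qed.

End PresentedQuotient.

Section PresentedAction.
Variables (I : choiceType) (R : set (word I)) (X : Type) (a : I -> X -> X).

(** The sign of a letter is ignored: this is an action when every generator acts as an
    involution. *)
Definition act_letters (x : X) (w : word I) : X := foldl (fun y l => a l.1 y) x w.

Hypothesis aK : forall i, involutive (a i).
Hypothesis aR : forall r, R r -> forall x, act_letters x r = x.

Definition pact (x : X) (g : presented R) : X := act_letters x (word_of_class g).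

Lemma act_letters_eq u v : word_eq R u v -> forall x, act_letters x u = act_letters x v.
Proof.
elim=> {u v} [//|u v _ IH x|u v w _ IHu _ IHv x|u u' v v' _ IHu _ IHv x|[i b] x|].
- by rewrite IH.
- by rewrite IHu.
- by rewrite /act_letters !foldl_cat -!/(act_letters _ _) IHu IHv.
- exact: aK.
- exact: aR.
Qed.

Lemma pactM x g h : pact x (g * h) = pact (pact x g) h.
Proof.
rewrite /pact -/(act_letters _ _) (act_letters_eq (word_of_class_eq R _)).
by rewrite /act_letters foldl_cat.
Qed.

Lemma pact_gen x i : pact x (pgen R i) = a i x.
Proof. by rewrite /pact (act_letters_eq (word_of_class_eq R _)). Qed.

Lemma pact1 x : pact x 1 = x.
Proof. by rewrite /pact (act_letters_eq (word_of_class_eq R _)). Qed.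

End PresentedAction.

(** * The reflections of [3,3,5] on the weight lattice *)

Section Weights.
Local Open Scope ring_scope.
Import GRing.Theory.

(** The pair (x, y) stands for x + y * phi, where phi, with phi^2 = phi + 1, is the golden
    ratio. *)
Definition zphi : Type := (int * int)%type.

Definition mul_phi (x : zphi) : zphi := (x.2, x.1 + x.2).

(** Coordinates in the basis of fundamental weights. *)
Definition weight : Type := (zphi * zphi * zphi * zphi)%type.

(** The reflection of index i subtracts v_i times the simple root of index i, which is the
    row of index i of the Cartan matrix in these coordinates.  Its entries are 2 on the
    diagonal, -1 for a bond of the diagram labelled 3 and - 2 cos (pi / 5) = - phi for the
    bond labelled 5. *)
Definition reflect600 (i : 'I_4) (v : weight) : weight :=
  let: (a, b, c, d) := v in
  match val i with
  | 0 => (- a, b + a, c, d)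
  | 1 => (a + b, - b, c + b, d)
  | 2 => (a, b + c, - c, d + mul_phi c)
  | _ => (a, b, c + mul_phi d, - d)
  end.

Definition base_weight : weight := ((1, 0), 0, 0, 0).

End Weights.

Ltac weight_eq := rewrite /reflect600 /mul_phi /=;
  congr (_, _, _, _); congr (_, _); rewrite /=; lia.

Lemma reflect600K i : involutive (reflect600 i).
Proof.
by case: i => -[|[|[|[|]]]] //= k [[[[a a'] [b b']] [c c']] [d d']]; weight_eq.
Qed.

(** The square of the rotation of order 5 in closed form; without it the terms of the fifth
    power grow exponentially. *)
Lemma reflect600_rot23 (i j : 'I_4) a b c d : i = 2 :> nat -> j = 3 :> nat ->
  let r v := reflect600 j (reflect600 i v) in
  r (r (a, b, c, d)) =
  (a, b + c + mul_phi c + mul_phi d, d, - (c + mul_phi d))%R.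
Proof.
case: i j => i iP [j jP] /= iE jE; subst i j.
by case: a b c d => [a a'] [b b'] [c c'] [d d']; weight_eq.
Qed.

Lemma reflect600_rot32 (i j : 'I_4) a b c d : i = 3 :> nat -> j = 2 :> nat ->
  let r v := reflect600 j (reflect600 i v) in
  r (r (a, b, c, d)) =
  (a, b + c + d + mul_phi (c + d), - (mul_phi c + d), c)%R.
Proof.
case: i j => i iP [j jP] /= iE jE; subst i j.
by case: a b c d => [a a'] [b b'] [c c'] [d d']; weight_eq.
Qed.

Lemma reflect600_relators r :
  coxeter_relators (fun i j : 'I_4 => linear_matrix [:: 3; 3; 5] i j) r ->
  forall v, act_letters reflect600 v r = v.
Proof.
case=> i [j ->] v.
have [/andP[/eqP i2 /eqP j3]|] := boolP ((i == 2 :> nat) && (j == 3 :> nat)).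
  case: v => [[[a b] c] d].
  rewrite /act_letters /linear_matrix i2 j3 /=.
  rewrite !(reflect600_rot23 _ _ _ _ i2 j3).
  case: i j i2 j3 => i iP [j jP] /= iE jE; subst i j.
  by case: a b c d => [a a'] [b b'] [c c'] [d d']; weight_eq.
have [/andP[/eqP i3 /eqP j2] _|] := boolP ((i == 3 :> nat) && (j == 2 :> nat)).
  case: v => [[[a b] c] d].
  rewrite /act_letters /linear_matrix i3 j2 /=.
  rewrite !(reflect600_rot32 _ _ _ _ i3 j2).
  case: i j i3 j2 => i iP [j jP] /= iE jE; subst i j.
  by case: a b c d => [a a'] [b b'] [c c'] [d d']; weight_eq.
move: i j v; do 2![case=> -[|[|[|[|//]]]] ?] => [] [[[[a a'] [b b']] [c c']] [d d']] //= _ _;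
  rewrite /act_letters /linear_matrix /=; weight_eq.
Qed.

Definition act600 (v : weight) (g : cell600_group) : weight := pact reflect600 v g.

Lemma act600M v g h : act600 v (g * h) = act600 (act600 v g) h.
Proof. exact: pactM reflect600K reflect600_relators v g h. Qed.

Lemma act600_1 v : act600 v 1 = v.
Proof. exact: pact1 reflect600K reflect600_relators v. Qed.

Lemma act600_tau v i : act600 v (tau600 i) = reflect600 i v.
Proof. exact: pact_gen reflect600K reflect600_relators v i. Qed.

Definition act_path (v : weight) (w : seq 'I_4) : weight :=
  foldl (fun u i => reflect600 i u) v w.

Lemma act600_ev v w : act600 v (ev600 w) = act_path v w.
Proof.
elim: w v => [|i w IH] v; first by rewrite /ev600 big_nil act600_1.
by rewrite ev600_cons act600M act600_tau IH.
Qed.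

Lemma tau600K i : tau600 i * tau600 i = 1.
Proof. by have := tau600_rel i i; rewrite /linear_matrix eqxx expg1. Qed.

Lemma ev600_rcons w i : ev600 (rcons w i) = ev600 w * tau600 i.
Proof. by rewrite -cats1 ev600_cat /ev600 big_seq1. Qed.

Definition letters (a b : nat) : seq 'I_4 :=
  [seq i : 'I_4 <- [:: @o4 0 isT; @o4 1 isT; @o4 2 isT; @o4 3 isT] | (a <= i < b)%N].

Lemma mem_letters a b i : (i \in letters a b) = (a <= i < b)%N.
Proof. by rewrite mem_filter andbC; case: i => -[|[|[|[|]]]]. Qed.

(** The corner of index j is the image of the first weight under the generators of index
    0, ..., j - 1 in turn; the first four are the vertices of the base tetrahedron. *)
Definition corner (j : nat) : weight := act_path base_weight (letters 0 j).

(** * Schreier trees for consecutive parabolic subgroups *)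

Local Notation segment600 := (segment tau600).

(** Breadth-first search of an orbit under the reflections in J.  Each point is stored with
    the word that leads to it from the root; words found in this order are as short as
    possible, hence reduced. *)
Fixpoint grow_tree (fuel : nat) (J : seq 'I_4) (queue tree : seq (weight * seq 'I_4)) :=
  match fuel, queue with
  | k.+1, (v, x) :: q =>
    let new := [seq p <- [seq (reflect600 i v, rcons x i) | i <- J]
                  | p.1 \notin [seq y.1 | y <- tree]] in
    grow_tree k J (q ++ new) (tree ++ new)
  | _, _ => tree
  end.

(** The orbit of the corner j under the generators of index j, ..., i - 1.  No orbit has
    more than 120 points, and each unit of fuel expands one of them. *)
Definition grown_tree (j i : nat) : seq (weight * seq 'I_4) :=
  let root := [:: (corner j, [::])] in grow_tree 120 (letters j i) root root.

Fact schreier_key : unit. Proof. exact: tt. Qed.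

Definition schreier_tree := locked_with schreier_key grown_tree.

Lemma schreier_treeE : schreier_tree = grown_tree.
Proof. exact: locked_withE. Qed.

Fixpoint lookup (v : weight) (T : seq (weight * seq 'I_4)) : option (seq 'I_4) :=
  if T is (u, x) :: T' then if u == v then Some x else lookup v T' else None.

(** Let x and x' be shortest words for two neighbouring points.  By Deodhar's lemma on
    minimal coset representatives, x followed by the generator i is either x', one letter
    longer or shorter than x, or it is t x' for a generator t of the stabilizer.  The words
    are compared in the direction in which both are reduced, for then the braid moves of
    strip_word are enough. *)
Definition edge_ok (L : seq 'I_4) (x : seq 'I_4) (i : 'I_4) (x' : seq 'I_4) : bool :=
  if size x' == (size x).+1 then strip_word (rcons x i) x'
  else if size x == (size x').+1 then strip_word (rcons x' i) x
  else has (fun t => strip_word (rcons x i) (t :: x')) L.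

(** The last clause is the substance: it certifies inside the presented group that the
    words represent all cosets of the stabilizer.  The others make sure that they represent
    distinct ones, which matters for counting. *)
Definition schreier_ok (j i : nat) : bool :=
  let T := schreier_tree j i in
  [&& uniq [seq y.1 | y <- T],
      all (fun y => act_path (corner j) y.2 == y.1) T,
      all (fun y => all (mem (letters j i)) y.2) T,
      lookup (corner j) T == Some [::] &
      all (fun y => all (fun k =>
        if lookup (reflect600 k y.1) T is Some x
        then edge_ok (letters j.+1 i) y.2 k x else false) (letters j i)) T].

Lemma schreier_okT j i : (j < i <= 4)%N -> schreier_ok j i.
Proof.
have okT : all (fun k => all (schreier_ok^~ k) (iota 0 k)) (iota 0 5).
  by rewrite /schreier_ok schreier_treeE; vm_cast_no_check (erefl true).
move=> /andP[ji i4]; have i5 : i \in iota 0 5 by rewrite mem_iota.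
by apply: (allP (allP okT i i5)); rewrite mem_iota.
Qed.

Lemma schreier_treeP j i : (j < i <= 4)%N ->
  let T := schreier_tree j i in
  [/\ uniq [seq y.1 | y <- T],
      forall y, y \in T -> act_path (corner j) y.2 = y.1,
      forall y, y \in T -> segment600 j i (ev600 y.2),
      lookup (corner j) T = Some [::] &
      forall y (k : 'I_4), y \in T -> (j <= k < i)%N ->
        if lookup (reflect600 k y.1) T is Some x
        then edge_ok (letters j.+1 i) y.2 k x else false].
Proof.
move=> ji T; have := schreier_okT ji; rewrite /schreier_ok -/T.
move: T => T /and5P[T_uniq /allP T_path /allP T_let /eqP T_root /allP T_edge].
split=> // [y /T_path /eqP //|y /T_let /allP y_let|y k /T_edge /allP/(_ k)].
  elim: y.2 y_let => [|k w IH] kw; first by rewrite /ev600 big_nil; apply: gen_one.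
  rewrite ev600_cons; apply: gen_mul; last first.
    by apply: IH => l lw; apply: kw; rewrite inE lw orbT.
  by apply: gen_image; rewrite /= -mem_letters; apply: kw; apply: mem_head.
by rewrite mem_letters => + jki; apply.
Qed.

Lemma lookup_mem v T x : lookup v T = Some x -> (v, x) \in T.
Proof.
elim: T => // -[u y] T IH /=; case: eqP => [-> [->]|_ /IH].
  exact: mem_head.
by rewrite inE orbC => ->.
Qed.

Lemma edge_okP j i x k x' : edge_ok (letters j.+1 i) x k x' ->
  exists2 h, segment600 j.+1 i h & ev600 x * tau600 k = h * ev600 x'.
Proof.
rewrite /edge_ok; case: ifP => _.
  by move=> /strip_wordP; rewrite ev600_rcons => <-; exists 1; [apply: gen_one|rewrite mul1g].
case: ifP => _.
  move=> /strip_wordP; rewrite ev600_rcons => ->; exists 1; first exact: gen_one.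
  by rewrite mul1g -mulgA tau600K mulg1.
move=> /hasP[t tL /strip_wordP]; rewrite ev600_rcons ev600_cons => <-.
by exists (tau600 t) => //; apply: gen_image; rewrite /= -mem_letters.
Qed.

(** Generators of larger index fix the corner: the reflection of index l moves only
    weights with a nonzero coordinate of index l. *)
Lemma corner_fix k (l : 'I_4) : (k < l)%N -> reflect600 l (corner k) == corner k.
Proof.
have ok : all (fun k => all (fun l => reflect600 l (corner k) == corner k)
                            (letters k.+1 4)) (iota 0 4) by vm_compute.
move=> kl; have k4 : k \in iota 0 4.
  by rewrite mem_iota (leq_trans kl) // ltnW.
by apply: (allP (allP ok k k4)); rewrite mem_letters kl ltn_ord.
Qed.

Lemma segment_fix j i k g : (k < j)%N -> segment600 j i g -> act600 (corner k) g = corner k.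
Proof.
move=> kj; move: g; apply: (gen_ind tau600K) => [|x l _ IH /= /andP[jl _]].
  exact: act600_1.
rewrite act600M IH act600_tau; apply/eqP.
exact: corner_fix (leq_trans kj jl).
Qed.

(** Schreier's lemma: along a word, each edge of the orbit graph contributes an element of
    the subgroup [j + 1, i) on the left, and what remains is the word stored at the end
    point. *)
Lemma segment_factor j i g : (j < i <= 4)%N -> segment600 j i g ->
  exists h x, [/\ lookup (act600 (corner j) g) (schreier_tree j i) = Some x,
                  segment600 j.+1 i h & g = h * ev600 x].
Proof.
move=> ji; have [_ _ _ root_ok edge] := schreier_treeP ji.
move: g; apply: (gen_ind tau600K) => [|g k _ [h [x [gx hL gE]]] /=].
  exists 1, [::]; rewrite act600_1 root_ok /ev600 big_nil mulg1; split => //.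
  exact: gen_one.
move=> jki; rewrite act600M act600_tau.
have := edge _ k (lookup_mem gx) jki; rewrite /=.
case: lookup => // x' /edge_okP[h' h'L E].
exists (h * h'), x'; split => //; first exact: gen_mul.
by rewrite gE -!mulgA E.
Qed.

(** The word stored at the root is empty. *)
Lemma segment_stab j i g : (j < i <= 4)%N -> segment600 j i g ->
  act600 (corner j) g = corner j -> segment600 j.+1 i g.
Proof.
move=> ji /(segment_factor ji)[h [x [+ hL gE]]] gj; rewrite gj gE.
have [_ _ _ -> _] := schreier_treeP ji.
by case=> <-; rewrite /ev600 big_nil mulg1.
Qed.

(** The segment [j, 4) fixes the corners of index less than j, and each of these removes one
    generator from the segment [0, i). *)
Lemma segment600I j i g : (j <= i <= 4)%N ->
  segment600 0 i g -> segment600 j 4 g -> segment600 j i g.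
Proof.
elim: j => // j IH /andP[ji i4] g0 gj.
apply: segment_stab; rewrite ?ji ?i4 //; last exact: segment_fix gj.
apply: IH; rewrite ?(ltnW ji) //.
by apply: gen_mono gj => k /= /andP[jk ->]; rewrite ltnW.
Qed.

(** * Vertices of the 600-cell as weights *)

Lemma segment600T : segment tau600 0 4 = [set: cell600_group].
Proof.
rewrite -(gen_pgen (coxeter_relators (fun i j : 'I_4 => linear_matrix [:: 3; 3; 5] i j))).
rewrite /segment; congr (gen (_ @` _)); apply/seteqP; split=> // k _.
exact: ltn_ord.
Qed.

Lemma segment600_stabilizer : segment tau600 1 4 = vertex_stabilizer tau600.
Proof.
rewrite /segment /vertex_stabilizer; congr (gen (_ @` _)); apply/seteqP.
by split=> k /=; rewrite -(inj_eq val_inj) ltn_ord andbT lt0n.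
Qed.

Lemma corner0 : corner 0 = base_weight. Proof. by []. Qed.

(** This identifies the vertices, which are cosets, with the points of an orbit. *)
Lemma base_weight_stab g :
  act600 base_weight g = base_weight <-> vertex_stabilizer tau600 g.
Proof.
rewrite -segment600_stabilizer -corner0; split=> [gE|g1]; last exact: segment_fix g1.
by apply: segment_stab => //; rewrite segment600T.
Qed.

Lemma act600_inj g : injective (act600^~ g).
Proof.
by move=> u v /(congr1 (act600^~ g^-1)); rewrite -!act600M mulgV !act600_1.
Qed.

Lemma base_vertexP (F : vert600) : exists g, F = vtrans base600 g.
Proof. by case: F => F /[dup] /set_mem[g _ <-] gP; exists g; apply: val_inj. Qed.

Lemma vtrans_base_eq g h : vtrans base600 g = vtrans base600 h <->
  act600 base_weight g = act600 base_weight h.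
Proof.
have stabE : act600 base_weight g = act600 base_weight h <->
    vertex_stabilizer tau600 (g * h^-1).
  rewrite -base_weight_stab act600M; split=> [->|E].
    by rewrite -act600M mulgV act600_1.
  by apply: (@act600_inj h^-1); rewrite E -act600M mulgV act600_1.
rewrite stabE; split=> [/(congr1 val) /= E|gh].
  have : rtranslate (vertex_stabilizer tau600) g g.
    by exists 1; [apply: gen_one|rewrite mul1g].
  by rewrite E => -[x Hx <-]; rewrite mulgK.
apply: val_inj; apply/seteqP; split=> _ [x Hx <-].
  by exists (x * (g * h^-1)); [apply: gen_mul|rewrite -!mulgA mulVg mulg1].
exists (x * (g * h^-1)^-1); first by apply: gen_mul => //; apply: gen_inv.
by rewrite invMg invgK -!mulgA mulVg mulg1.
Qed.

(** The weight does not depend on the representative of the coset, by [vtrans_base_eq]. *)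
Definition vertex_weight (F : vert600) : weight :=
  act600 base_weight (projT1 (cid (base_vertexP F))).

Lemma vertex_weight_base g : vertex_weight (vtrans base600 g) = act600 base_weight g.
Proof. by rewrite /vertex_weight; case: cid => h /= /vtrans_base_eq. Qed.

Lemma vertex_weight_inj : injective vertex_weight.
Proof.
move=> E F; have [g ->] := base_vertexP E; have [h ->] := base_vertexP F.
by rewrite !vertex_weight_base => /vtrans_base_eq.
Qed.

Definition vertex_weights : seq weight := [seq y.1 | y <- schreier_tree 0 4].

Lemma vertex_weight_mem F : vertex_weight F \in vertex_weights.
Proof.
have [g ->] := base_vertexP F; rewrite vertex_weight_base.
have gT : segment tau600 0 4 g by rewrite segment600T.
have [h [x [/lookup_mem gx _ _]]] := segment_factor (isT : (0 < 4 <= 4)%N) gT.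
exact: (map_f fst gx).
Qed.

Lemma vertex_of_weight v : v \in vertex_weights -> exists F, vertex_weight F = v.
Proof.
rewrite /vertex_weights => /mapP[y yT ->]; exists (vtrans base600 (ev600 y.2)).
have [_ path _ _ _] := schreier_treeP (isT : (0 < 4 <= 4)%N).
by rewrite vertex_weight_base act600_ev -path.
Qed.

Lemma reflect600N i v : reflect600 i (- v)%R = (- reflect600 i v)%R.
Proof.
case: i v => -[|[|[|[|//]]]] ? [[[[a a'] [b b']] [c c']] [d d']]; weight_eq.
Qed.

Lemma act600N v g : act600 (- v)%R g = (- act600 v g)%R.
Proof.
move: g; apply: pres_ind => [i||g i gE].
- exact: tau600K.
- by rewrite !act600_1.
- by rewrite !act600M gE !act600_tau reflect600N.
Qed.

(** Being central, the involution acts on the whole orbit as it does on its first weight,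
    which it negates. *)
Lemma vertex_weight_alpha F :
  vertex_weight (vtrans F cell600_alpha) = (- vertex_weight F)%R.
Proof.
have [g ->] := base_vertexP F.
rewrite -vtransM !vertex_weight_base -cell600_alpha_central act600M -act600N.
congr (act600 _ g); rewrite cell600_alphaE act600_ev.
by apply/eqP; vm_cast_no_check (erefl true).
Qed.

(** * The sixty axes *)

(** One weight from each antipodal pair: the one that is listed first. *)
Definition axis_representatives (V : seq weight) : seq weight :=
  [seq v <- V | (index v V < index (- v)%R V)%N].

Definition axes_ok (V : seq weight) : bool :=
  let H := axis_representatives V in
  (size H == 60) && all (fun v => ((- v)%R \in H) == (v \notin H)) V.

Lemma axes_okT : axes_ok vertex_weights.
Proof. by rewrite /vertex_weights schreier_treeE; vm_cast_no_check (erefl true). Qed.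

Definition axis_weights : seq weight := axis_representatives vertex_weights.

Lemma size_axis_weights : size axis_weights = 60.
Proof. by have /andP[/eqP] := axes_okT. Qed.

Lemma axis_weights_opp v : v \in vertex_weights ->
  ((- v)%R \in axis_weights) = (v \notin axis_weights).
Proof. by have /andP[_ /allP ok] := axes_okT => /ok/eqP. Qed.

Lemma axis_weights_uniq : uniq axis_weights.
Proof.
have [T_uniq _ _ _ _] := schreier_treeP (isT : (0 < 4 <= 4)%N).
exact: filter_uniq.
Qed.

Lemma axis_weights_sub v : v \in axis_weights -> v \in vertex_weights.
Proof. by rewrite mem_filter => /andP[]. Qed.

Definition axis_weight (F : vert600) : weight :=
  if vertex_weight F \in axis_weights then vertex_weight F else (- vertex_weight F)%R.

Lemma axis_weight_mem F : axis_weight F \in axis_weights.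
Proof.
rewrite /axis_weight; case: ifPn => //.
by rewrite axis_weights_opp ?vertex_weight_mem.
Qed.

Lemma axis_index_lt F : (index (axis_weight F) axis_weights < 60)%N.
Proof. by rewrite -size_axis_weights index_mem axis_weight_mem. Qed.

(** The Boolean tells the two ends of an axis apart. *)
Definition axis (F : vert600) : 'I_60 * bool :=
  (Ordinal (axis_index_lt F), vertex_weight F \in axis_weights).

Lemma axis_eq E F : ((axis F).1 == (axis E).1) = (F == E) || (F == vtrans E cell600_alpha).
Proof.
have -> : ((axis F).1 == (axis E).1) = (axis_weight F == axis_weight E).
  rewrite -(inj_eq val_inj) /=; apply/eqP/eqP => [|->] //.
  by apply: (index_inj 0%R); exact: axis_weight_mem.
rewrite -!(inj_eq vertex_weight_inj) vertex_weight_alpha /axis_weight.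
have := axis_weights_opp (vertex_weight_mem E).
have := axis_weights_opp (vertex_weight_mem F).
move: (vertex_weight E) (vertex_weight F) => u v Fv Eu.
have oppE : ((- v)%R == u) = (v == (- u)%R) by rewrite GRing.eqr_oppLR.
case: ifPn => vh; case: ifPn => uh; rewrite ?GRing.eqr_opp ?oppE.
- case: (v =P (- u)%R) => [vE|]; rewrite ?orbF ?orbT //.
  by rewrite vE Eu uh in vh.
- by case: (v =P u) => [vE|] //; rewrite vE (negPf uh) in vh.
- by case: (v =P u) => [vE|] //; rewrite -vE (negPf vh) in uh.
- case: (v =P (- u)%R) => [vE|]; rewrite ?orbF ?orbT //.
  by rewrite vE Eu uh in vh.
Qed.

Lemma axis_bij : bijective axis.
Proof.
have weight_axis (x : 'I_60 * bool) : exists F, axis F = x.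
  case: x => i t; have i_lt : (i < size axis_weights)%N by rewrite size_axis_weights.
  pose v := nth 0%R axis_weights i; have vh : v \in axis_weights by apply: mem_nth.
  have iE : index v axis_weights = i by rewrite index_uniq ?axis_weights_uniq.
  have [F Fv] := vertex_of_weight (axis_weights_sub vh).
  pose E := if t then F else vtrans F cell600_alpha; exists E.
  have Et : vertex_weight E = if t then v else (- v)%R.
    by rewrite /E; case: t {E}; rewrite // vertex_weight_alpha Fv.
  have Nvh : ((- v)%R \in axis_weights) = false by rewrite axis_weights_opp ?axis_weights_sub // vh.
  congr (_, _); last by rewrite Et; case: (t); rewrite ?Nvh.
  apply: val_inj; rewrite /= /axis_weight Et -[RHS]iE; congr index.
  by case: (t); rewrite ?vh // Nvh GRing.opprK.
have axis_inj : injective axis.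
  move=> E F EF; apply: vertex_weight_inj.
  have := congr1 fst EF => /(congr1 val) /=.
  move=> /(index_inj 0%R (axis_weight_mem _) (axis_weight_mem _)); rewrite /axis_weight.
  have := congr1 snd EF => /= ->.
  by case: ifP => // _ /GRing.oppr_inj.
have [g gK] := choice weight_axis.
by exists g => // F; apply: axis_inj; rewrite gK.
Qed.

Lemma antipodal_axis s E F : antipodal_matrix cell600_alpha s E F =
  if E == F then 1%N else if (axis F).1 == (axis E).1 then s else 2.
Proof. by rewrite /antipodal_matrix axis_eq [F == E]eq_sym; case: eqVneq. Qed.

(** * Coxeter groups that are powers of a dihedral group *)

Section Dihedral.
Variables (G : groupType) (s : nat) (a b : G).

(** The normal form of an element of the group generated by the involutions a and b: a
    power of the rotation a * b, followed by a or not. *)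
Definition dihedral_word (c : 'I_s * bool) : G := (a * b) ^+ c.1 * a ^+ c.2.

Hypotheses (s0 : (0 < s)%N) (a2 : a * a = 1) (b2 : b * b = 1).
Hypothesis abs : (a * b) ^+ s = 1.

Lemma dihedral_word_exp j (t : bool) :
  exists c, (a * b) ^+ j * a ^+ t = dihedral_word c.
Proof.
exists (Ordinal (ltn_pmod j s0), t); rewrite /dihedral_word /=.
by rewrite {1}(divn_eq j s) mulnC expgnDr expgM abs expg1n mul1g.
Qed.

Lemma dihedral_word1 : exists c, 1 = dihedral_word c.
Proof.
by have [c E] := dihedral_word_exp 0 false; exists c; rewrite -E mulg1.
Qed.

Lemma dihedral_wordMa c : exists c', dihedral_word c * a = dihedral_word c'.
Proof.
case: c => k t; exists (k, ~~ t); rewrite /dihedral_word -mulgA.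
by case: t; rewrite /= ?expg1 ?expg0 ?a2 ?mul1g.
Qed.

Lemma dihedral_wordMb c : exists c', dihedral_word c * b = dihedral_word c'.
Proof.
case: c => k [].
  have [c' E] := dihedral_word_exp k.+1 false; exists c'; rewrite -E.
  by rewrite /dihedral_word expg1 expg0 mulg1 expgSr mulgA.
(* The exponent k - 1, made nonnegative by adding s. *)
have [c' E] := dihedral_word_exp (k + s.-1) true; exists c'; rewrite -E.
rewrite /dihedral_word /= expg1 expg0 mulg1; apply: (mulIg b).
by rewrite -2!mulgA b2 mulg1 -expgSr -addnS prednK // expgnDr abs mulg1.
Qed.

End Dihedral.

(** The words exhaust the group and there are as many of them as elements, so they are
    pairwise distinct. *)
Lemma dihedral_gtype_words (s : nat) : (1 < s)%N ->
  exists a b : gsort 'D_(2 * s),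
    [/\ a * a = 1, b * b = 1, (a * b) ^+ s = 1 &
        bijective (dihedral_word (s := s) a b)].
Proof.
move=> s1; rewrite mul2n; have s0 := ltnW s1.
have /existsP[[a b] /eqP] : 'D_(s.*2) \homg Grp (x : y : x ^+ 2, y ^+ 2, (x * y) ^+ s).
  by rewrite -Grp'_dihedral // homg_refl.
rewrite /= => -[genT] a2 b2 abs; exists a, b; split=> //.
have surj z : exists c, z = dihedral_word (s := s) a b c.
  have : z \in ([set a] <*> [set b])%SET by rewrite -joing_idl -joing_idr genT inE.
  case/gen_prodgP=> n [c cab ->]; elim: n c cab => [|n IH] c cab.
    by rewrite big_ord0; apply: dihedral_word1.
  rewrite big_ord_recr /=; have [i|d ->] := IH (fun i => c (widen_ord (leqnSn n) i)).
    exact: cab.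
  have := cab ord_max; rewrite !inE => /orP[] /eqP ->.
    exact: dihedral_wordMa.
  exact: dihedral_wordMb.
have [c cK] := choice surj.
apply: (@Bijective _ _ _ c) => // x.
(* A section of a surjection between finite sets of equal size is onto. *)
have c_inj : injective c by move=> y z E; rewrite (cK y) (cK z) E.
have card_le : (#|{: 'I_s * bool}| <= #|{: gsort 'D_(s.*2)}|)%N.
  by rewrite card_prod card_ord card_bool muln2 -cardsT card_dihedral.
have /codomP[z ->] := inj_card_onto c_inj card_le x.
by rewrite -cK.
Qed.

Section DihedralPower.
Variables (T : choiceType) (q s : nat) (e : T -> 'I_q * bool) (M : T -> T -> nat).
Hypothesis s1 : (1 < s)%N.
Hypothesis ME : forall E F,
  M E F = if E == F then 1%N else if (e F).1 == (e E).1 then s else 2.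

Notation W := (coxeter M).
Notation sg := (cgen M).

Lemma cgen2 E : sg E * sg E = 1.
Proof. by have := cgen_rel M E E; rewrite ME eqxx expg1. Qed.

Lemma cgen_commute E F : (e F).1 != (e E).1 -> commute (sg E) (sg F).
Proof.
move=> EF; apply: commute_involutions; try exact: cgen2.
have := cgen_rel M E F; rewrite ME (negPf EF); case: eqVneq => // EF'.
by rewrite EF' eqxx in EF.
Qed.

Variable einv : 'I_q * bool -> T.
Hypotheses (eK : cancel e einv) (einvK : cancel einv e).

(** Elements of different axes commute, so one dihedral normal form for each axis suffices. *)
Definition dihedral_normal (c : {ffun 'I_q -> 'I_s * bool}) : W :=
  \prod_i dihedral_word (sg (einv (i, false))) (sg (einv (i, true))) (c i).

Lemma dihedral_normal_surj w : exists c, w = dihedral_normal c.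
Proof.
have s0 := ltnW s1.
have ab i : (sg (einv (i, false)) * sg (einv (i, true))) ^+ s = 1.
  have := cgen_rel M (einv (i, false)) (einv (i, true)).
  by rewrite ME (can_eq einvK) xpair_eqE andbF !einvK eqxx.
move: w; apply: pres_ind => [||x E [c ->]]; first exact: cgen2.
  exists [ffun=> (Ordinal s0, false)]; rewrite /dihedral_normal big1 // => i _.
  by rewrite ffunE /dihedral_word !expg0 mulg1.
rewrite -/(cgen M E) -[E]eK; case: (e E) => j t.
pose n := dihedral_word (s := s) (sg (einv (j, false))) (sg (einv (j, true))).
have [d dE] : exists d, n (c j) * sg (einv (j, t)) = n d.
  by case: t; [exact: dihedral_wordMb (cgen2 _) (ab j) _|exact: dihedral_wordMa (cgen2 _) _].
exists [ffun i => if i == j then d else c i].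
rewrite /dihedral_normal (prod_mul_commute (j := j)) ?index_enum_uniq ?mem_index_enum //.
  by apply: eq_bigr => i _; rewrite ffunE; case: eqVneq => // ->.
move=> i ij; apply: commute_sym; apply: commuteM; apply: commuteX;
  do ?apply: commuteM; apply: cgen_commute; rewrite !einvK //.
Qed.

(** A coordinate of the map to the dihedral power: all axes but one are killed. *)
Lemma dihedral_projection (a b : gsort 'D_(2 * s)) (i : 'I_q) :
    a * a = 1 -> b * b = 1 -> (a * b) ^+ s = 1 ->
  exists p : {multiplicative W -> gsort 'D_(2 * s)}, forall E,
    p (sg E) = if (e E).1 == i then (if (e E).2 then b else a) else 1.
Proof.
move=> a2 b2 abs; pose d E : gsort 'D_(2 * s) :=
  if (e E).1 == i then (if (e E).2 then b else a) else 1.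
have d2 E : d E * d E = 1.
  by rewrite /d; case: ifP => _; [case: ifP|rewrite mul1g].
apply: (coxeter_eval (f := d)) => E F; rewrite ME.
case: eqVneq => [->|EF]; first by rewrite expg1 d2.
case: eqVneq => [EF1|EF1]; last first.
  rewrite /d; case: eqVneq => [Ei|_]; case: eqVneq => [Fi|_].
  - by rewrite Ei Fi eqxx in EF1.
  - by case: ifP; rewrite mulg1.
  - by case: ifP; rewrite mul1g.
  - by rewrite mul1g expg1n.
rewrite /d EF1; case: eqP => _; last by rewrite mul1g expg1n.
have bas := mulg_involutions_exp a2 b2 abs.
have : (e E).2 != (e F).2.
  apply: contra_neq EF => EF2; apply: (can_inj eK).
  by rewrite [LHS]surjective_pairing [RHS]surjective_pairing EF1 EF2.
by case: (e E).2 (e F).2 => [] [].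
Qed.

(** The normal forms exhaust the Coxeter group, and their images are all the elements of the
    dihedral power, each once; so the map is bijective without any prior knowledge of the
    order of the Coxeter group.  The second part tells the axes of the generators apart. *)
Lemma dihedral_power :
  exists f : {multiplicative W -> {ffun 'I_q -> gsort 'D_(2 * s)}},
    bijective f /\ forall E i, (f (sg E) i == 1) = (i != (e E).1).
Proof.
have [a [b [a2 b2 abs dih_bij]]] := dihedral_gtype_words s1.
have dih1 k (ks : (k < s)%N) : dihedral_word a b (Ordinal ks, true) != 1.
  have s0 := ltnW s1.
  have <- : dihedral_word a b (Ordinal s0, false) = 1.
    by rewrite /dihedral_word !expg0 mulg1.
  by rewrite (bij_eq dih_bij) xpair_eqE andbF.
have a1 : a != 1.
  by have := dih1 0%N (ltnW s1); rewrite /dihedral_word expg0 mul1g.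
have b1 : b != 1.
  by have := dih1 1%N s1; apply: contra_neq => b1; rewrite /dihedral_word b1 mulg1.
have [p pgenE] := choice (fun i => dihedral_projection i a2 b2 abs).
pose f (w : W) : {ffun 'I_q -> gsort 'D_(2 * s)} := [ffun i => p i w].
have pM i : {morph p i : x y / x * y} by apply: gmulfM.
have fM : {morph f : x y / x * y}.
  by move=> x y; apply/ffunP => i; rewrite !ffunE pM.
have fE c i : f (dihedral_normal c) i = dihedral_word a b (c i).
  rewrite ffunE /dihedral_normal (big_morph (p i) (pM i) (morph_one (pM i))).
  transitivity (\prod_j if j == i then dihedral_word a b (c j) else 1).
    apply: eq_bigr => j _; rewrite /dihedral_word pM !(morph_exp (pM i)) pM !pgenE !einvK /=.
    by case: ifP => //; rewrite mul1g !expg1n mul1g.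
  by rewrite -big_mkcond big_pred1_eq.
exists (multiplicative_of fM); split.
  have [dinv dinvK dK] := dih_bij.
  pose g h := dihedral_normal [ffun i => dinv (h i)].
  apply: (@Bijective _ _ _ (fun h : {ffun 'I_q -> gsort 'D_(2 * s)} => g h)) => [w|h].
    have [c ->] := dihedral_normal_surj w; rewrite /g; congr dihedral_normal.
    by apply/ffunP => i; rewrite ffunE -[RHS]dinvK -fE.
  by apply/ffunP => i; rewrite [LHS]fE ffunE dK.
move=> E i; rewrite [X in X == _]ffunE pgenE; case: (eqVneq (e E).1 i) => _.
  by case: (e E).2; rewrite ?(negPf a1) ?(negPf b1).
by rewrite eqxx.
Qed.

End DihedralPower.

Lemma two_W_dihedral s : (1 < s)%N ->
  exists f : {multiplicative cell600_two_W s -> {ffun 'I_60 -> gsort 'D_(2 * s)}},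
    bijective f /\
    forall F i, (f (sigma (n := 3) (tau := tau600) cell600_alpha s F) i == 1) =
                (i != (axis F).1).
Proof.
move=> s1; have [einv eK einvK] := axis_bij.
exact: (dihedral_power s1 (antipodal_axis s) eK einvK).
Qed.

(** * The semidirect product as a string C-group *)

Section SemidirectLemmas.
Variables (G W : groupType) (to : gaction G W).
Notation inl := (sd_inl to).
Notation inr := (sd_inr to).

Lemma sd_mulE (x y : semidirect to) : x * y = (x.1 * y.1, to x.2 y.1 * y.2) :> semidirect to.
Proof. by []. Qed.

Lemma sd_inrM : {morph inr : g h / g * h}.
Proof. by move=> g h; rewrite sd_mulE /sd_inr /= Defs.gact1 mulg1. Qed.

Lemma sd_inlM : {morph inl : v w / v * w}.
Proof. by move=> v w; rewrite sd_mulE /sd_inl /= gact_1 mulg1. Qed.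

Lemma sd_inl_inr w g : inl w * inr g = inr g * inl (to w g).
Proof. by rewrite !sd_mulE /sd_inl /sd_inr /= Defs.gact1 !mulg1 !mul1g. Qed.

Lemma sd_inr_inl (x : semidirect to) : x = inr x.1 * inl x.2.
Proof. by rewrite sd_mulE /sd_inl /sd_inr /= Defs.gact1 mul1g mulg1; case: x. Qed.

Lemma sd_inrX g k : inr (g ^+ k) = inr g ^+ k.
Proof. exact: (morph_exp sd_inrM). Qed.

Lemma sd_inlX w k : inl (w ^+ k) = inl w ^+ k.
Proof. exact: (morph_exp sd_inlM). Qed.

End SemidirectLemmas.

Section Two600.
Variable s : nat.

Notation TG := (cell600_two_group s).
Notation to := (two_action tau600 s cell600_alpha_central).
Notation inl := (sd_inl to).
Notation inr := (sd_inr to).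
Notation rho := (cell600_two_rho s).
Notation sg := (sigma (tau := tau600) cell600_alpha s).

Lemma two_rho0 : rho ord0 = inl (sg base600).
Proof. by rewrite /cell600_two_rho /two_rho unlift_none. Qed.

Lemma two_rhoS j : rho (lift ord0 j) = inr (tau600 j).
Proof. by rewrite /cell600_two_rho /two_rho liftK. Qed.

Lemma sigma2 F : sg F * sg F = 1.
Proof.
have := cgen_rel (@antipodal_matrix 3 cell600_group tau600 cell600_alpha s) F F.
by rewrite /antipodal_matrix eqxx expg1.
Qed.

Lemma inl_sigma_inr F g : inl (sg F) * inr g = inr g * inl (sg (vtrans F g)).
Proof.
rewrite sd_inl_inr; congr (_ * inl _).
by apply: two_act_gen; apply: cell600_alpha_central.
Qed.

Lemma base_fix (k : 'I_4) : (0 < k)%N -> vtrans base600 (tau600 k) = base600.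
Proof.
move=> k0; rewrite -[RHS]vtrans1; apply/vtrans_base_eq.
by rewrite act600_1 act600_tau; apply/eqP/(@corner_fix 0).
Qed.

Lemma two_rho2 i : rho i * rho i = 1.
Proof.
case: (unliftP ord0 i) => [j ->|->].
  by rewrite two_rhoS -sd_inrM tau600K.
by rewrite two_rho0 -sd_inlM sigma2.
Qed.

Lemma tau600_commute (i j : 'I_4) : (i + 2 <= j)%N -> commute (tau600 i) (tau600 j).
Proof.
move=> ij; apply: commute_involutions; try exact: tau600K.
have := tau600_rel i j; rewrite /linear_matrix.
by rewrite !ifN //; lia.
Qed.

(** The base vertex is fixed by all generators of [3,3,5] but the first. *)
Lemma two_rho_commute (i j : 'I_5) : (i + 2 <= j)%N -> commute (rho i) (rho j).
Proof.
case: (unliftP ord0 j) => [j' ->|->]; last by rewrite addn2.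
rewrite two_rhoS; case: (unliftP ord0 i) => [i' ->|->] ij.
  by rewrite two_rhoS /commute -!sd_inrM tau600_commute.
by rewrite two_rho0 /commute inl_sigma_inr base_fix.
Qed.

Lemma segment_inr a b g :
  segment tau600 a b g -> segment rho a.+1 b.+1 (inr g).
Proof.
move: g; apply: (gen_ind tau600K) => [|g k _ IH kab]; first exact: gen_one.
by rewrite sd_inrM; apply: gen_mul => //; rewrite -two_rhoS; apply: gen_image.
Qed.

(** The projection to G kills the first generator and shifts the index of the others. *)
Lemma segment_two_fst b x : segment rho 0 b.+1 x -> segment tau600 0 b x.1.
Proof.
move: x; apply: (gen_ind two_rho2) => [|x k _ IH /= kb]; first exact: gen_one.
apply: gen_mul => //; move: kb.
case: (unliftP ord0 k) => [j ->|-> _].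
  by rewrite two_rhoS => jb; apply: gen_image.
by rewrite two_rho0; apply: gen_one.
Qed.

Lemma segment_two_inr a x : segment rho a.+1 5 x ->
  exists2 g, segment tau600 a 4 g & x = inr g.
Proof.
move: x; apply: (gen_ind two_rho2) => [|x k _ [g ga ->] /= /andP[ak _]].
  by exists 1 => //; apply: gen_one.
move: ak; case: (unliftP ord0 k) => [j ->|-> //] aj.
exists (g * tau600 j); last by rewrite two_rhoS sd_inrM.
by apply: gen_mul => //; apply: gen_image; rewrite /= ltn_ord andbT.
Qed.

(** If j > 0 the element lies in G, where its projection is itself; the intersection is
    therefore computed in G. *)
Lemma segment_two_I j i x : (j <= i <= 5)%N ->
  segment rho 0 i x -> segment rho j 5 x -> segment rho j i x.
Proof.
case: j i => [|j] [|i] //; rewrite !ltnS => ji x0i /segment_two_inr[g gj xE].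
rewrite xE in x0i *; apply: segment_inr; apply: segment600I => //.
exact: (segment_two_fst x0i).
Qed.

(** The generators of W are the conjugates of the first generator under G. *)
Lemma gen_two_rho : gen (range rho) = [set: TG].
Proof.
have inr_gen g : gen (range rho) (inr g).
  have : segment tau600 0 4 g by rewrite segment600T.
  by move=> /segment_inr; apply: gen_mono.
rewrite eqEsubset; split=> // x _; rewrite (sd_inr_inl x).
apply: gen_mul => //; move: x.2; apply: pres_ind => [F||w F IH].
- exact: sigma2.
- exact: gen_one.
rewrite sd_inlM; apply: gen_mul => //; have [g ->] := base_vertexP F.
apply: (gen_cancell (inr_gen g)); rewrite -inl_sigma_inr; apply: gen_mul => //.
by rewrite -two_rho0; apply: gen_image.
Qed.

(** In the dihedral power, a generator is nontrivial on its own axis. *)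
Lemma sigma_neq1 F : (1 < s)%N -> sg F <> 1.
Proof.
move=> s1; have [f [_ fE]] := two_W_dihedral s1 => F1.
have := fE F (axis F).1; rewrite eqxx (_ : f _ = 1); first by rewrite ffunE eqxx.
by rewrite [sigma _ _ _]F1; apply: morph_one; apply: gmulfM.
Qed.

Lemma sigma_axis E F : (1 < s)%N -> sg E = sg F -> (axis E).1 = (axis F).1.
Proof.
move=> s1; have [f [_ fE]] := two_W_dihedral s1 => EF.
by have := fE E (axis F).1; rewrite [sigma _ _ _]EF fE eqxx => /esym/negPn/eqP.
Qed.

(** The reflection of index k sends the corner of index k to the next one. *)
Lemma corner_moved (k : 'I_4) : reflect600 k (corner k) != corner k.
Proof.
have ok : all (fun i => reflect600 i (corner i) != corner i) (letters 0 4).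
  by vm_cast_no_check (erefl true).
by apply: (allP ok); rewrite mem_letters ltn_ord.
Qed.

Lemma tau600_neq1 k : tau600 k <> 1.
Proof.
by move=> k1; have /negP[] := corner_moved k; rewrite -act600_tau k1 act600_1.
Qed.

(** Two generators are distinct because the later one fixes a corner that the earlier one
    moves. *)
Lemma tau600_mul_neq1 (k l : 'I_4) : (k < l)%N -> tau600 k * tau600 l <> 1.
Proof.
move=> kl kl1; have /negP[] := corner_moved k; rewrite -act600_tau.
have -> : tau600 k = tau600 l.
  by apply: (mulIg (tau600 l)); rewrite kl1 tau600K.
by rewrite act600_tau corner_fix.
Qed.

Lemma two_string_C_group : (1 < s)%N -> string_C_group rho.
Proof.
move=> s1; apply: string_C_groupI => [||||i].
- exact: two_rho2.
- exact: two_rho_commute.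
- exact: segment_two_I.
- exact: gen_two_rho.
- case: (unliftP ord0 i) => [j ->|->].
    by rewrite two_rhoS => /(congr1 fst); apply: tau600_neq1.
  by rewrite two_rho0 => /(congr1 snd); apply: sigma_neq1.
Qed.

(** * Relations and orders of products of generators *)

Lemma vertex_weight_base1 : vertex_weight base600 = base_weight.
Proof. by rewrite -[base600]vtrans1 vertex_weight_base act600_1. Qed.

Lemma antipodal_base w :
  antipodal_matrix cell600_alpha s base600 (vtrans base600 (ev600 w)) =
  if base_weight == act_path base_weight w then 1%N
  else if act_path base_weight w == (- base_weight)%R then s else 2.
Proof.
rewrite /antipodal_matrix -!(inj_eq vertex_weight_inj) vertex_weight_alpha.
by rewrite vertex_weight_base vertex_weight_base1 act600_ev.
Qed.

Lemma sigma_rel E F : (sg E * sg F) ^+ antipodal_matrix cell600_alpha s E F = 1.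
Proof. exact: (cgen_rel (@antipodal_matrix 3 cell600_group tau600 cell600_alpha s)). Qed.

(** This is the form of the additional relators: a product of the generators of W at the
    base vertex and at one of its translates. *)
Lemma two_rho0_conj g :
  rho ord0 * (inr g)^-1 * rho ord0 * inr g = inl (sg base600 * sg (vtrans base600 g)).
Proof.
by rewrite two_rho0 -!mulgA inl_sigma_inr mulKg -sd_inlM.
Qed.

Lemma linear_matrixS i j :
  linear_matrix [:: 4; 3; 3; 5] i.+1 j.+1 = linear_matrix [:: 3; 3; 5] i j.
Proof. by rewrite /linear_matrix !eqSS minnSS. Qed.

Lemma neighbor_axis :
  (axis base600).1 != (axis (vtrans base600 (tau600 ord0))).1.
Proof.
rewrite eq_sym axis_eq -!(inj_eq vertex_weight_inj) vertex_weight_alpha.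
by rewrite vertex_weight_base vertex_weight_base1 act600_tau.
Qed.

Lemma antipodal_neighbor :
  antipodal_matrix cell600_alpha s base600 (vtrans base600 (tau600 ord0)) = 2.
Proof.
have nE := neighbor_axis.
have EF : base600 != vtrans base600 (tau600 ord0) by apply: contra_neq nE => <-.
by rewrite antipodal_axis (negPf EF) eq_sym (negPf nE).
Qed.

Lemma two_rho01_sqr :
  (rho ord0 * rho (lift ord0 ord0)) ^+ 2 =
  inl (sg base600 * sg (vtrans base600 (tau600 ord0))).
Proof.
rewrite -two_rho0_conj -two_rhoS expgS expg1 !mulgA; congr (_ * _ * _ * _).
by apply: (mulgI (rho (lift ord0 ord0))); rewrite mulgV two_rho2.
Qed.

(** Only the bond labelled 4 is new: the square of the product of the first two generators
    is the product of the generators of W at the two ends of the base edge, which commute. *)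
Lemma two_rho_rel (i j : 'I_5) :
  (rho i * rho j) ^+ linear_matrix [:: 4; 3; 3; 5] i j = 1.
Proof.
have rel0 k : (rho ord0 * rho k) ^+ linear_matrix [:: 4; 3; 3; 5] 0 k = 1.
  case: (unliftP ord0 k) => [k' ->|->]; last by rewrite expg1 two_rho2.
  have [->|k0] := eqVneq k' ord0.
    rewrite (_ : linear_matrix _ _ _ = 2 * 2)%N // expgM two_rho01_sqr -sd_inlX.
    have := sigma_rel base600 (vtrans base600 (tau600 ord0)).
    by rewrite antipodal_neighbor => ->.
  rewrite (_ : linear_matrix _ _ _ = 2); last first.
    by case: k' k0 => -[|[|[|[|]]]].
  have ck := @two_rho_commute ord0 (lift ord0 k').
  rewrite expgS expg1 {1}ck; last by rewrite /= add0n ltnS lt0n.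
  by rewrite -mulgA (mulgA (rho ord0)) two_rho2 mul1g two_rho2.
case: (unliftP ord0 i) => [i' ->|->]; last exact: rel0.
case: (unliftP ord0 j) => [j' ->|->].
  by rewrite !two_rhoS linear_matrixS -sd_inrM -sd_inrX tau600_rel.
rewrite (_ : linear_matrix _ _ _ = linear_matrix [:: 4; 3; 3; 5] 0 (lift ord0 i')).
  by apply: mulg_involutions_exp; rewrite ?two_rho2.
by case: i' => -[|[|[|[|]]]].
Qed.

(** The orders 3 and 5 are prime, so it is enough that the products are nontrivial.  For the
    order 4, the ends of the base edge lie on different axes, so the square is nontrivial. *)
Lemma two_schlafli : (1 < s)%N -> schlafli_type rho [:: 4; 3; 3; 5].
Proof.
move=> s1; split=> // i j; case: (unliftP ord0 j) => [j' ->|-> //].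
have rel := two_rho_rel i (lift ord0 j'); move: rel.
case: (unliftP ord0 i) => [i' ->|->] rel ji.
  have {}ji : j' = i'.+1 :> nat by apply: succn_inj; exact: ji.
  have nthE : linear_matrix [:: 4; 3; 3; 5] (lift ord0 i') (lift ord0 j') =
              nth 0%N [:: 4; 3; 3; 5] (lift ord0 i').
    rewrite linear_matrixS /linear_matrix ji.
    by case: i' {ji rel} => -[|[|[|[|]]]].
  rewrite nthE in rel; apply: has_order_prime rel _.
    by case: i' ji {nthE} => -[|[|[|[|]]]] //= _; case: j' => -[|[|[|[|]]]].
  rewrite !two_rhoS -sd_inrM => /(congr1 fst).
  by apply: tau600_mul_neq1; rewrite ji.
have j0 : j' = ord0 by apply: val_inj; apply: succn_inj; exact: ji.
rewrite {}j0 in rel *; apply: has_order4 => //.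
rewrite two_rho01_sqr => /(congr1 snd) /= F1.
have /negP[] := neighbor_axis; apply/eqP/sigma_axis => //.
by apply: (mulIg (sg (vtrans base600 (tau600 ord0)))); rewrite sigma2.
Qed.

End Two600.

(** * Orders of the groups *)

Definition listed (T : eqType) (A : T -> Prop) (n : nat) : Prop :=
  exists r : seq T, [/\ uniq r, size r = n & forall x, A x <-> x \in r].

Lemma listed_card (T : choiceType) n :
  listed (fun _ : T => True) n -> ([set: T]%classic #= `I_n)%card.
Proof.
case=> r [r_uniq <- rT]; have {}rT x : x \in r by apply/rT.
apply/card_set_bijP; exists (index^~ r); split=> [x _|x y _ _ xy|i /= ir].
- by rewrite /= index_mem.
- exact: (index_inj x).
- case: r r_uniq rT ir => [|x0 r] // r_uniq rT ir.
  by exists (nth x0 (x0 :: r) i); rewrite // index_uniq.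
Qed.

Lemma listed_bijective (T : eqType) (U : finType) (f : T -> U) :
  bijective f -> listed (fun _ : T => True) #|U|.
Proof.
case=> g fK gK; exists [seq g u | u <- enum U]; split.
- by rewrite map_inj_uniq ?enum_uniq //; apply: can_inj gK.
- by rewrite size_map -cardE.
- by move=> x; split=> // _; rewrite -[x]fK map_f // mem_enum.
Qed.

Lemma lookup_uniq v x T :
  uniq [seq y.1 | y <- T] -> (v, x) \in T -> lookup v T = Some x.
Proof.
elim: T => //= -[u y] T IH /= /andP[uT T_uniq]; rewrite inE xpair_eqE.
case: (eqVneq v u) => [->|_] /=; last exact: IH.
case: eqP => [-> //|_] /= uxT.
by rewrite (map_f fst uxT) in uT.
Qed.

(** The words stored in the tree represent the cosets of the stabilizer [j + 1, i). *)
Lemma listed_segment j i n : (j < i <= 4)%N -> listed (segment tau600 j.+1 i) n ->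
  listed (segment tau600 j i) (size (schreier_tree j i) * n).
Proof.
move=> ji [r [r_uniq <- rE]]; have [T_uniq T_path T_seg _ _] := schreier_treeP ji.
have fix_j h y : h \in r -> y \in schreier_tree j i ->
    act600 (corner j) (h * ev600 y.2) = y.1.
  move=> /rE hL yT; rewrite act600M (segment_fix _ hL) // act600_ev.
  exact: T_path.
exists [seq h * ev600 y.2 | y <- schreier_tree j i, h <- r]; split.
- apply: allpairs_uniq => //; first exact: map_uniq T_uniq.
  move=> _ _ /allpairsP[[y h] [/= yT hr ->]] /allpairsP[[y' h'] [/= yT' hr' ->]] /= E.
  have y1E : y.1 = y'.1 by rewrite -(fix_j h y) // E fix_j.
  have yE : y = y'.
    case: y y' yT yT' y1E {E} => [v x] [v' x'] /= /(lookup_uniq T_uniq) vx.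
    by move=> /(lookup_uniq T_uniq) vx' vE; move: vx'; rewrite -vE vx => -[->].
  by rewrite yE in E *; rewrite (mulIg _ _ _ E).
- by rewrite size_allpairs.
- move=> g; split.
    move=> /(segment_factor ji)[h [x [/lookup_mem gx hL gE]]].
    by apply/allpairsP; exists (act600 (corner j) g, x, h); split; [exact: gx|apply/rE|exact: gE].
  case/allpairsP=> -[y h] /= [yT /rE hr ->]; apply: gen_mul; last exact: T_seg.
  by apply: gen_mono hr => k /= /andP[jk ->]; rewrite ltnW.
Qed.

(** The chain of stabilizers of the vertices of the base tetrahedron has the indices 120, 12,
    5 and 2. *)
Lemma cell600_group_listed : listed (fun _ : cell600_group => True) 14400.
Proof.
have tree_sizes : [seq size (schreier_tree j 4) | j <- iota 0 4] = [:: 120; 12; 5; 2].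
  by rewrite schreier_treeE; vm_cast_no_check (erefl [:: 120; 12; 5; 2]).
have listed4 : listed (segment tau600 4 4) 1.
  exists [:: 1]; split=> // x; rewrite inE; split=> [x4|/eqP ->]; last exact: gen_one.
  apply/eqP; move: x x4; apply: (gen_ind tau600K) => // x k _ _ /= /andP[k4].
  by rewrite ltnNge k4.
have : listed (segment tau600 0 4) (size (schreier_tree 0 4) *
    (size (schreier_tree 1 4) * (size (schreier_tree 2 4) * (size (schreier_tree 3 4) * 1)))).
  by do 4!apply: listed_segment => //.
case: tree_sizes => -> -> -> -> [r [r_uniq rn rE]].
by exists r; split=> // x; rewrite -rE segment600T.
Qed.

Lemma card_two_group s : (1 < s)%N ->
  ([set: cell600_two_group s]%classic #= `I_(14400 * (2 * s) ^ 60)%classic)%card.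
Proof.
move=> s1; apply: listed_card.
have [r [r_uniq <- rT]] := cell600_group_listed.
have [f [f_bij _]] := two_W_dihedral s1.
have [t [t_uniq tn tT]] := listed_bijective f_bij.
have -> : ((2 * s) ^ 60)%N = size t.
  rewrite tn card_ffun card_ord -cardsT mul2n; congr (_ ^ _)%N.
  by rewrite card_dihedral.
exists [seq (g, w) : cell600_two_group s | g <- r, w <- t]; split.
- by apply: allpairs_uniq => // -[g w] [g' w'] _ _ /= [-> ->].
- by rewrite size_allpairs.
- move=> [g w]; split=> // _; apply/allpairsP; exists (g, w).
  by split=> //; [apply/rT|apply/tT].
Qed.

(** * Double cosets of the vertex stabilizer *)

Definition coxeter_element (G : groupType) (r : 'I_5 -> G) : G :=
  r (inord 1) * r (inord 2) * r (inord 3) * r (inord 4).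

(** Powers of the Coxeter element, as words. *)
Definition beta_word (i : nat) : seq 'I_4 := flatten (nseq i (letters 0 4)).

Lemma ev600_rev w : ev600 (rev w) = (ev600 w)^-1.
Proof.
elim: w => [|k w IH]; first by rewrite /ev600 big_nil invg1.
by rewrite rev_cons ev600_rcons IH ev600_cons invMg tau600_inv.
Qed.

(** Braid moves turn a reduced word of the central element into its reverse. *)
Lemma alpha_invol : cell600_alpha * cell600_alpha = 1.
Proof.
have /strip_wordP E : strip_word alpha_word (rev alpha_word).
  by vm_cast_no_check (erefl true).
by rewrite {1}cell600_alphaE -E ev600_rev -cell600_alphaE mulVg.
Qed.

Lemma inord_lift (k : nat) (kP : (k < 4)%N) : inord k.+1 = lift ord0 (o4 kP) :> 'I_5.
Proof. by apply: val_inj; rewrite /= inordK. Qed.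

Lemma coxeter_element_morph (G : groupType) (r : 'I_5 -> G) (f : cell600_group -> G) i :
    {morph f : x y / x * y} -> (forall k, f (tau600 k) = r (lift ord0 k)) ->
  f (ev600 (beta_word i)) = coxeter_element r ^+ i.
Proof.
move=> fM ft; have -> : ev600 (beta_word i) = ev600 (letters 0 4) ^+ i.
  elim: i => [|i IH]; first by rewrite /ev600 big_nil.
  by rewrite expgS -IH -ev600_cat.
rewrite (morph_exp fM); congr (_ ^+ i); rewrite /coxeter_element.
rewrite (inord_lift (isT : 0 < 4)%N) (inord_lift (isT : 1 < 4)%N).
rewrite (inord_lift (isT : 2 < 4)%N) (inord_lift (isT : 3 < 4)%N).
by rewrite /= !ev600_cons /ev600 big_nil mulg1 !fM !ft !mulgA.
Qed.

(** One vertex from each orbit of the stabilizer H of the base vertex.  The orbits are layers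
    at constant distance from the base vertex; the word of one letter gives its
    neighbours and the power 15 its antipode. *)
Definition double_coset_words : seq (seq 'I_4) :=
  [:: [::], [:: @o4 0 isT] & [seq beta_word i | i <- [:: 4; 6; 7; 9; 10; 12; 15]]].

Lemma grow_tree_ind (P : weight -> Prop) n J queue tree :
    (forall v k, P v -> k \in J -> P (reflect600 k v)) ->
    (forall y, y \in queue -> P y.1) -> (forall y, y \in tree -> P y.1) ->
  forall y, y \in grow_tree n J queue tree -> P y.1.
Proof.
move=> PJ; elim: n queue tree => [|n IH] [|[v x] q] tree //= Pq Pt y.
have Pv : P v by apply: (Pq (v, x)); apply: mem_head.
set new := filter _ _.
have Pnew z : z \in new -> P z.1.
  by rewrite mem_filter => /andP[_ /mapP[k kJ ->]]; apply: PJ.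
apply: IH => z; rewrite mem_cat => /orP[zq|]; [|exact: Pnew|exact: Pt|exact: Pnew].
by apply: Pq; rewrite inE zq orbT.
Qed.

(** The search that starts from the nine representatives and uses only generators of H
    reaches all 120 vertices.  Hence a property that depends only on the image of the base
    vertex, and is stable under H, is settled by nine cases. *)
Lemma double_coset_ind (P : cell600_group -> Prop) :
    (forall g h, act600 base_weight g = act600 base_weight h -> P g -> P h) ->
    (forall g (k : 'I_4), (0 < k)%N -> P g -> P (g * tau600 k)) ->
    (forall w, w \in double_coset_words -> P (ev600 w)) ->
  forall g, P g.
Proof.
move=> Peq Pmul Pw g.
pose roots := [seq (act_path base_weight w, w) | w <- double_coset_words].
have : all (mem [seq y.1 | y <- grow_tree 120 (letters 1 4) roots roots]) vertex_weights.
  by rewrite /vertex_weights schreier_treeE; vm_cast_no_check (erefl true).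
pose P' v := forall h, act600 base_weight h = v -> P h.
have Proots y : y \in roots -> P' y.1.
  move=> /mapP[w wD ->] h /= hw; apply: (Peq (ev600 w)); last exact: Pw.
  by rewrite act600_ev.
have : forall y, y \in grow_tree 120 (letters 1 4) roots roots -> P' y.1.
  apply: grow_tree_ind => // u k Pu; rewrite mem_letters => /andP[k0 _] h hE.
  rewrite -[h]mulg1 -(tau600K k) mulgA; apply: Pmul => //; apply: Pu.
  by rewrite act600M hE act600_tau reflect600K.
move: (grow_tree _ _ _ _) => T PT /allP cover.
have /cover/mapP[y yT gy] := vertex_weight_mem (vtrans base600 g).
by apply: (PT y yT); rewrite -gy vertex_weight_base.
Qed.

Lemma antipodal_beta s i : i \in [:: 4; 6; 7; 9; 10; 12] ->
  antipodal_matrix cell600_alpha s base600 (vtrans base600 (ev600 (beta_word i))) = 2.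
Proof.
have ok : all (fun i => let v := act_path base_weight (beta_word i) in
    (base_weight != v) && (v != (- base_weight)%R)) [:: 4; 6; 7; 9; 10; 12].
  by vm_cast_no_check (erefl true).
by move=> /(allP ok)/andP[/negPf v1 /negPf va]; rewrite antipodal_base v1 va.
Qed.

Lemma antipodal_beta15 s :
  antipodal_matrix cell600_alpha s base600 (vtrans base600 (ev600 (beta_word 15))) = s.
Proof.
have : let v := act_path base_weight (beta_word 15) in
    (base_weight != v) && (v == (- base_weight)%R).
  by vm_cast_no_check (erefl true).
by move=> /andP[/negPf v1 va]; rewrite antipodal_base v1 va.
Qed.

(** * The presentation of the semidirect product *)

Section Universal.
Variables (s : nat) (Q : groupType) (r : 'I_5 -> Q).
Notation b := (coxeter_element r).
Hypothesis r_rel : forall i j, (r i * r j) ^+ linear_matrix [:: 4; 3; 3; 5] i j = 1.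
Hypothesis r_beta : forall i, i \in [:: 4; 6; 7; 9; 10; 12] ->
  (r ord0 * b ^- i * r ord0 * b ^+ i) ^+ 2 = 1.
Hypothesis r_alpha : (r ord0 * b ^+ 15 * r ord0 * b ^+ 15) ^+ s = 1.

Notation sg := (sigma (tau := tau600) cell600_alpha s).
Notation antipodal := (@antipodal_matrix 3 cell600_group tau600 cell600_alpha s).

(** The generator of W at the vertex F0 g has to be sent to the conjugate of the first
    generator by the image of g.  This is well defined because the first generator commutes
    with the image of H.  The relation between the vertices F0 g and F0 h is
    conjugate to the one between F0 and F0 h g^-1, which depends only on the double coset
    of h g^-1. *)
Lemma universal_two_group :
  exists psi : {multiplicative cell600_two_group s -> Q},
    forall i, psi (cell600_two_rho s i) = r i.
Proof.
have r2 i : r i * r i = 1.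
  by have := r_rel i i; rewrite /linear_matrix eqxx expg1.
have [phi phi_gen] : exists phi : {multiplicative cell600_group -> Q},
    forall k, phi (tau600 k) = r (lift ord0 k).
  apply: (coxeter_eval (f := fun k => r (lift ord0 k))) => i j.
  by rewrite -linear_matrixS; apply: r_rel.
have phiM : {morph phi : g h / g * h} by exact: gmulfM.
have phi_beta i : phi (ev600 (beta_word i)) = b ^+ i by exact: coxeter_element_morph.
pose c g := r ord0 ^ phi g.
have cM g h : c (g * h) = c g ^ phi h by rewrite /c phiM conjgM.
have c_stab h : vertex_stabilizer tau600 h -> c h = r ord0.
  rewrite -segment600_stabilizer; move: h.
  apply: (gen_ind tau600K) => [|h k _ IH /= /andP[k0 _]].
    by rewrite /c (morph_one phiM) conjg1.
  rewrite cM IH phi_gen; apply/conjg_fixP/commgP.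
  apply: commute_involutions; rewrite ?r2 // -[RHS](r_rel ord0 (lift ord0 k)).
  by congr (_ ^+ _); case: k k0 => -[|[|[|[|]]]].
have c_eq g h : act600 base_weight g = act600 base_weight h -> c g = c h.
  move=> gh; have : vertex_stabilizer tau600 (g * h^-1).
    by apply/base_weight_stab; rewrite act600M gh -act600M mulgV act600_1.
  by move=> /c_stab E; rewrite -[g](mulgVK h) cM E.
(* The nine double cosets: conjugation by an element of H fixes the first generator, so
   the relation passes from a vertex to its H-orbit. *)
have c_rel0 g : (r ord0 * c g) ^+ antipodal base600 (vtrans base600 g) = 1.
  pose P g := (r ord0 * c g) ^+ antipodal base600 (vtrans base600 g) = 1.
  apply: (double_coset_ind (P := P)) => {g} [g h gh|g k k0 IH|w]; rewrite /P.
  - by rewrite (c_eq _ _ gh) (iffRL (vtrans_base_eq _ _) gh).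
  - have tk : vtrans base600 (tau600 k) = base600 by apply: base_fix.
    have stab_k : vertex_stabilizer tau600 (tau600 k).
      by apply: gen_image; rewrite /= -(inj_eq val_inj) -lt0n.
    rewrite -[X in antipodal X _]tk vtransM antipodal_matrix_trans; last first.
      exact: cell600_alpha_central.
    have r0k : r ord0 = r ord0 ^ phi (tau600 k) by rewrite -[LHS](c_stab _ stab_k).
    by rewrite cM {1}r0k -conjMg -conjXg IH conj1g.
  - rewrite inE => /orP[/eqP -> |].
      by rewrite antipodal_base /ev600 big_nil c_stab ?r2 //; apply: gen_one.
    rewrite inE => /orP[/eqP -> |/mapP[i iD ->]].
      (* With t the image of the first reflection, r0 * r0 ^ t is (r0 * t)^2, and the bond labelled
         4 gives the relation. *)
      rewrite antipodal_base /ev600 big_seq1 /c phi_gen conjgE (rhoV r2).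
      have := r_rel ord0 (lift ord0 (@o4 0 isT)); rewrite (expgM _ 2 2) => E.
      rewrite (_ : _ * _ = (r ord0 * r (lift ord0 (@o4 0 isT))) ^+ 2) //.
      by rewrite expgS expg1 -mulgA.
    have : i \in rcons [:: 4; 6; 7; 9; 10; 12] 15 by [].
    rewrite mem_rcons inE {iD} => /orP[/eqP -> |iD].
      (* The relator has the power 15 in place of its inverse; they agree as the central
         element is an involution. *)
      have bV : b ^- 15 = b ^+ 15.
        rewrite -phi_beta -(morph_inv phiM); congr (phi _).
        rewrite (_ : ev600 _ = cell600_alpha); last exact/esym/cell600_alphaE.
        by apply: (mulgI cell600_alpha); rewrite mulgV alpha_invol.
      by rewrite antipodal_beta15 /c phi_beta mulg_conjg bV r_alpha.
    by rewrite antipodal_beta // /c phi_beta mulg_conjg r_beta.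
pose rep F := projT1 (cid (base_vertexP F)).
have repE F : vtrans base600 (rep F) = F by rewrite /rep; case: cid => g /= ->.
have [psiW psiW_gen] : exists psiW : {multiplicative cell600_two_W s -> Q},
    forall F, psiW (sg F) = c (rep F).
  apply: (coxeter_eval (f := fun F => c (rep F))) => E F.
  have -> : antipodal E F = antipodal base600 (vtrans base600 (rep F * (rep E)^-1)).
    rewrite -(antipodal_matrix_trans s cell600_alpha_central (rep E) base600).
    by rewrite -vtransM mulgVK !repE.
  have := c_rel0 (rep F * (rep E)^-1); set m := antipodal _ _ => E1.
  have -> : c (rep E) * c (rep F) = (r ord0 * c (rep F * (rep E)^-1)) ^ phi (rep E).
    by rewrite conjMg -cM mulgVK.
  by rewrite -conjXg E1 conj1g.
have psiWM : {morph psiW : v w / v * w} by exact: gmulfM.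
have c_rep g : c (rep (vtrans base600 g)) = c g.
  by apply: c_eq; apply/vtrans_base_eq; rewrite repE.
have psiW_act w g : psiW (two_act w g) = psiW w ^ phi g.
  apply: (pres_morph_ext (f := fun w => psiW (two_act w g)) (g := fun w => psiW w ^ phi g)).
  - by move=> u v; rewrite two_actM ?psiWM //; apply: cell600_alpha_central.
  - by move=> u v; rewrite psiWM conjMg.
  - move=> F; rewrite [two_act _ _](two_act_gen s cell600_alpha_central) -/(sg F).
    by rewrite !psiW_gen -cM -[in LHS](repE F) -vtransM c_rep.
pose psi (x : cell600_two_group s) := phi x.1 * psiW x.2.
have psiM : {morph psi : x y / x * y}.
  move=> x y; rewrite /psi [(x * y).1]/(x.1 * y.1).
  rewrite -[(x * y).2]/(two_act x.2 y.1 * y.2) phiM psiWM psiW_act.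
  rewrite -[LHS]mulgA -[RHS]mulgA; congr (_ * _).
  by rewrite [LHS]mulgA -conjgC [RHS]mulgA.
exists (multiplicative_of psiM) => i; rewrite /= /psi.
case: (unliftP ord0 i) => [j ->|->].
  by rewrite two_rhoS /= (morph_one psiWM) mulg1 phi_gen.
rewrite two_rho0 /= (morph_one phiM) mul1g psiW_gen -[base600]vtrans1 c_rep.
by rewrite /c (morph_one phiM) conjg1.
Qed.

End Universal.

Section Relators.
Variables (s : nat) (K : groupType) (r : 'I_5 -> K).
Notation L := (linear_coxeter [:: 4; 3; 3; 5]).
Notation b := (coxeter_element r).
Variable q : {multiplicative L -> K}.
Hypothesis q_gen : forall i, q (@lgen [:: 4; 3; 3; 5] i) = r i.

(** Both directions are needed: with the semidirect product as target, to see that the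
    relators hold there; with the presented quotient, to extract the relations that the
    universal property asks for. *)
Lemma relators_trivial_iff :
  (forall a, cell600_two_relators s a -> q a = 1) <->
  (forall i, i \in [:: 4; 6; 7; 9; 10; 12] ->
     (r ord0 * b ^- i * r ord0 * b ^+ i) ^+ 2 = 1) /\
  (r ord0 * b ^+ 15 * r ord0 * b ^+ 15) ^+ s = 1.
Proof.
have qM : {morph q : x y / x * y} by exact: gmulfM.
have ord0E : inord 0 = ord0 :> 'I_5 by apply: val_inj; rewrite /= inordK.
pose lb := coxeter_element (@lgen [:: 4; 3; 3; 5]).
have q_b i : q (lb ^+ i) = b ^+ i.
  by rewrite (morph_exp qM) /lb /coxeter_element !qM !q_gen.
have q_bV i : q (lb ^- i) = b ^- i by rewrite (morph_inv qM) q_b.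
have q4 x y z t : q (x * y * z * t) = q x * q y * q z * q t by rewrite !qM.
pose l0 := @lgen [:: 4; 3; 3; 5] (inord 0).
have q_beta i : q ((l0 * lb ^- i * l0 * lb ^+ i) ^+ 2) =
    (r ord0 * b ^- i * r ord0 * b ^+ i) ^+ 2.
  by rewrite (morph_exp qM) q4 q_b q_bV q_gen ord0E.
have q_alpha : q ((l0 * lb ^+ 15 * l0 * lb ^+ 15) ^+ s) =
    (r ord0 * b ^+ 15 * r ord0 * b ^+ 15) ^+ s.
  by rewrite (morph_exp qM) q4 q_b q_gen ord0E.
split=> [q1|[r_beta r_alpha] a].
  split=> [i iD|]; first by rewrite -q_beta; apply: q1; left; exists i.
  by rewrite -q_alpha; apply: q1; right.
case=> [[i /= iD <-]|->]; last by rewrite -r_alpha -q_alpha.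
by rewrite -(r_beta i iD) -q_beta.
Qed.

End Relators.

Lemma two_rho_relators s
    (f : {multiplicative linear_coxeter [:: 4; 3; 3; 5] -> cell600_two_group s}) :
    (forall i, f (@lgen [:: 4; 3; 3; 5] i) = cell600_two_rho s i) ->
  forall a, cell600_two_relators s a -> f a = 1.
Proof.
move=> fE; apply/(relators_trivial_iff s fE).
pose inr := sd_inr (two_action tau600 s cell600_alpha_central).
have inr_beta i : inr (ev600 (beta_word i)) = coxeter_element (cell600_two_rho s) ^+ i.
  apply: coxeter_element_morph => [x y|k]; first exact: sd_inrM.
  by rewrite two_rhoS.
pose F i := vtrans base600 (ev600 (beta_word i)).
split=> [i iD|].
  rewrite -inr_beta two_rho0_conj -sd_inlX.
  by have := sigma_rel s base600 (F i); rewrite antipodal_beta // => ->.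
have betaV : inr (ev600 (beta_word 15)) = (inr (ev600 (beta_word 15)))^-1.
  rewrite (_ : ev600 _ = cell600_alpha); last exact/esym/cell600_alphaE.
  by apply: (mulgI (inr cell600_alpha)); rewrite mulgV -sd_inrM alpha_invol.
rewrite -inr_beta {1}betaV two_rho0_conj -sd_inlX.
by have := sigma_rel s base600 (F 15); rewrite antipodal_beta15 => ->.
Qed.

Lemma two_group_presented (s : nat) :
  exists f : {multiplicative linear_coxeter [:: 4; 3; 3; 5] -> cell600_two_group s},
    (forall i : 'I_5, f (@lgen [:: 4; 3; 3; 5] i) = cell600_two_rho s i) /\
    is_quotient_by f (cell600_two_relators s).
Proof.
have [f fE] :
    exists f : {multiplicative linear_coxeter [:: 4; 3; 3; 5] -> cell600_two_group s},
      forall i : 'I_5, f (@lgen [:: 4; 3; 3; 5] i) = cell600_two_rho s i.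
  exact: coxeter_eval (@two_rho_rel s).
exists f; split=> //; split.
  move=> y; have : gen (range (cell600_two_rho s)) y by rewrite gen_two_rho.
  move: y; apply: (gen_ind (@two_rho2 s)) => [|y i _ [x <-] _].
    by exists 1; apply: morph_one; exact: gmulfM.
  by exists (x * @lgen [:: 4; 3; 3; 5] i); rewrite gmulfM fE.
have [q q_class] := quotient_morphism (cell600_two_relators s).
have q_kill := quotient_morphism_kill q_class.
pose R' := quotient_relators (cell600_two_relators s).
have q_gen i : q (@lgen [:: 4; 3; 3; 5] i) = pgen R' i by apply: q_class.
have [q_beta q_alpha] := (relators_trivial_iff s q_gen).1 q_kill.
have qM : {morph q : x y / x * y} by exact: gmulfM.
have q_rel i j : (pgen R' i * pgen R' j) ^+ linear_matrix [:: 4; 3; 3; 5] i j = 1.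
  rewrite -!q_gen -qM -(morph_exp qM) [X in q X]cgen_rel.
  exact: (morph_one qM).
have [psi psiE] := universal_two_group q_rel q_beta q_alpha.
apply: (preim1_normal_closure q_class (g := psi)) => [|i].
  exact: two_rho_relators.
by rewrite [f _]fE.
Qed.

Theorem corollary4p7 (s : nat) (hs : (2 <= s)%N) :
  [/\ string_C_group (cell600_two_rho s),
      schlafli_type (cell600_two_rho s) [:: 4; 3; 3; 5],
      isomorphic (cell600_two_W s) {ffun 'I_60 -> gsort 'D_(2 * s)},
      ([set: cell600_two_group s]%classic #= `I_(14400 * (2 * s) ^ 60)%classic)%card
    & exists f : {multiplicative linear_coxeter [:: 4; 3; 3; 5]
                                 -> cell600_two_group s},
        (forall i : 'I_5, f (@lgen [:: 4; 3; 3; 5] i) = cell600_two_rho s i) /\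
        is_quotient_by f (cell600_two_relators s)].
Proof.
split; [exact: two_string_C_group|exact: two_schlafli| |exact: card_two_group|].
  by have [f [f_bij _]] := two_W_dihedral hs; exists f.
exact: two_group_presented.
Qed.
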